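(* From a construction sequence for an $n$-vertex graph $G$ with $p$ resolve operations, one can construct in $O(p+n)$ time a signed tree model of $G$ with at most $n+p$ transversal pairs.
   Context: A construction sequence of $G$ with vertex set $V$ is a sequence $(\mathcal P_1,E_1,N_1),\dots,(\mathcal P_m,E_m,N_m)$ of partitions $\mathcal P_i$ of $V$ and sets $E_i,N_i\subseteq\binom V2$, starting with singletons and $E_1=N_1=\emptyset$, each step being a merge (replace parts $A,B$ by $A\cup B$), a positive resolve (for parts $A,B$, possibly equal, $E_{i+1}=E_i\cup(AB\setminus N_i)$ with $AB$ the pairs between $A$ and $B$) or a negative resolve ($N_{i+1}=N_i\cup(AB\setminus E_i)$); the constructed graph $(V,E_m)$ is $G$. A transversal pair of a rooted tree $T$ is an unordered pair $uv$ of distinct nodes neither of which is an ancestor of the other ($\preceq_T$ is the ancestor relation). Two pairs $u_1v_1,u_2v_2$ cross if one of $u_1,v_1$ is a strict ancestor of one of $u_2,v_2$ and vice versa. A signed tree model is $(T,A,B)$ with $T$ a full binary rooted tree and $A,B$ disjoint sets of pairwise non-crossing transversal pairs; its number of transversal pairs is $|A|+|B|$. A pair $u'v'\in A\cup B$ covers nodes $u,v$ if $u'\preceq_T u$, $v'\preceq_T v$ and no other pair $u''v''\in A\cup B$ has $u'\preceq_T u''\preceq_T u$, $v'\preceq_T v''\preceq_T v$. It is a signed tree model of $G$ if $G$ is the graph on the leaves where two leaves are adjacent iff covered by a pair of $B$. *)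

(* Defs.v *)
From mathcomp Require Import all_boot.

Set Implicit Arguments.
Unset Strict Implicit.
Unset Printing Implicit Defensive.

Record sgraph (V : Type) := SGraph {
  adj :> rel V;
  adj_sym : symmetric adj;
  adj_irr : irreflexive adj }.

(** ** Construction sequences *)

Section Construction.
Variable V : finType.

(* The pairs AB: 2-subsets with one element in A and the other in B; for
   A = B these are all the 2-subsets of A. *)
Definition pairs_between (A B : {set V}) : {set {set V}} :=
  [set [set x; y] | x in A, y in B & x != y].

Record cstate := CState {
  cparts : {set {set V}};
  cE : {set {set V}};
  cN : {set {set V}} }.

Definition cinit : cstate := CState [set [set v] | v : V] set0 set0.

Inductive cop :=
| Merge of {set V} & {set V}
| PosResolve of {set V} & {set V}
| NegResolve of {set V} & {set V}.

Inductive cstep (s : cstate) : cop -> cstate -> Prop :=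
| CMerge A B of A \in cparts s & B \in cparts s & A != B :
    cstep s (Merge A B)
      (CState ((A :|: B) |: ((cparts s :\ A) :\ B)) (cE s) (cN s))
| CPos A B of A \in cparts s & B \in cparts s :
    cstep s (PosResolve A B)
      (CState (cparts s) (cE s :|: (pairs_between A B :\: cN s)) (cN s))
| CNeg A B of A \in cparts s & B \in cparts s :
    cstep s (NegResolve A B)
      (CState (cparts s) (cE s) (cN s :|: (pairs_between A B :\: cE s))).

(* [ops] records which operation leads from each triple of [ss] to the next:
   the triples alone do not determine it (nor the number of resolves), since a
   resolve may leave its triple unchanged. *)
Definition construction_sequence (ss : seq cstate) (ops : seq cop) : Prop :=
  [/\ size ss = (size ops).+1,
      nth cinit ss 0 = cinit &
      forall i, i < size ops ->
        exists2 o, onth ops i = Some o &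
                   cstep (nth cinit ss i) o (nth cinit ss i.+1)].

Definition constructs (ss : seq cstate) (G : sgraph V) : Prop :=
  forall x y : V, G x y = ([set x; y] \in cE (last cinit ss)).

Definition is_resolve (o : cop) : bool :=
  if o is Merge _ _ then false else true.

Definition num_resolves (ops : seq cop) : nat := count is_resolve ops.

End Construction.

Arguments cinit {V}.

(** ** Rooted trees and signed tree models *)

(* A rooted tree on the node set N is given by its parent function; the root is
   its own parent. *)
Record rtree (N : finType) := RTree {
  root : N;
  parent : N -> N;
  parent_root : parent root = root;
  root_reached : forall x, exists k, iter k parent x = root }.

Section Trees.
Variables (N : finType) (T : rtree N).

Definition anc (u v : N) : Prop := exists k, iter k (parent T) v = u.
Definition sanc (u v : N) : Prop := anc u v /\ u <> v.

Definition children (x : N) : {set N} :=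
  [set y | (y != root T) && (parent T y == x)].
Definition is_leaf (x : N) : bool := children x == set0.
Definition full_binary : Prop :=
  forall x, #|children x| = 0 \/ #|children x| = 2.

Definition transversal (P : {set N}) : Prop :=
  exists u v, [/\ P = [set u; v], u <> v, ~ anc u v & ~ anc v u].

Definition cross (P Q : {set N}) : Prop :=
  (exists x y, [/\ x \in P, y \in Q & sanc x y]) /\
  (exists x y, [/\ x \in Q, y \in P & sanc x y]).

End Trees.

Record signed_tree_model (N : finType) := SignedTreeModel {
  stm_tree : rtree N;
  stm_A : {set {set N}};
  stm_B : {set {set N}};
  stm_full : full_binary stm_tree;
  stm_disjoint : [disjoint stm_A & stm_B];
  stm_transversal : forall P, P \in stm_A :|: stm_B -> transversal stm_tree P;
  stm_noncrossing : forall P Q, P \in stm_A :|: stm_B ->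
    Q \in stm_A :|: stm_B -> ~ cross stm_tree P Q }.

Section Models.
Variables (N : finType) (M : signed_tree_model N).
Let T := stm_tree M.

Definition num_pairs : nat := #|stm_A M| + #|stm_B M|.

Definition covers (P : {set N}) (u v : N) : Prop :=
  P \in stm_A M :|: stm_B M /\
  exists u' v',
    [/\ P = [set u'; v'], anc T u' u, anc T v' v &
        ~ (exists u'' v'',
             [/\ [set u''; v''] \in stm_A M :|: stm_B M, [set u''; v''] <> P,
                 anc T u' u'' /\ anc T u'' u & anc T v' v'' /\ anc T v'' v])].

(* [lf] identifies the vertices of G with the leaves of the tree. *)
Definition model_of (V : finType) (lf : V -> N) (G : sgraph V) : Prop :=
  [/\ injective lf,
      forall x, is_leaf T x <-> exists v, lf v = x &
      forall v w, v <> w ->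
        (G v w <-> exists2 P, P \in stm_B M & covers P (lf v) (lf w))].

End Models.

(** ** Word RAM *)

(* Structured programs over registers and an addressable memory, both indexed
   by and holding natural numbers, with an append-only output tape.  Every
   operation has unit cost.  The only arithmetic is addition and truncated
   subtraction, and no value or address >= W may be written, so that words have
   log2 W bits. *)

Inductive expr :=
| Cst of nat
| Reg of nat
| Mem of expr
| Add of expr & expr
| Sub of expr & expr.

Inductive test :=
| Lt of expr & expr
| Eq of expr & expr.

Inductive cmd :=
| Skip
| Assign of nat & expr
| Store of expr & expr
| Out of expr
| Seq of cmd & cmd
| If of test & cmd & cmd
| While of test & cmd.

Record mstate := MState {
  regs : nat -> nat;
  mem : nat -> nat;
  out : seq nat }.

Fixpoint eval (s : mstate) (e : expr) : nat :=
  match e with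
  | Cst k => k
  | Reg r => regs s r
  | Mem a => mem s (eval s a)
  | Add e1 e2 => eval s e1 + eval s e2
  | Sub e1 e2 => eval s e1 - eval s e2
  end.

Fixpoint ecost (e : expr) : nat :=
  match e with
  | Cst _ | Reg _ => 1
  | Mem a => (ecost a).+1
  | Add e1 e2 | Sub e1 e2 => (ecost e1 + ecost e2).+1
  end.

Definition teval (s : mstate) (b : test) : bool :=
  match b with
  | Lt e1 e2 => eval s e1 < eval s e2
  | Eq e1 e2 => eval s e1 == eval s e2
  end.

Definition tcost (b : test) : nat :=
  match b with Lt e1 e2 | Eq e1 e2 => (ecost e1 + ecost e2).+1 end.

Definition upd (f : nat -> nat) (x v : nat) : nat -> nat :=
  fun y => if y == x then v else f y.

(* [exec W c s t s']: from state s the command c halts in state s' after t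
   elementary operations. *)
Inductive exec (W : nat) : cmd -> mstate -> nat -> mstate -> Prop :=
| XSkip s : exec W Skip s 1 s
| XAssign s x e of eval s e < W :
    exec W (Assign x e) s (ecost e).+1
      (MState (upd (regs s) x (eval s e)) (mem s) (out s))
| XStore s a e of eval s a < W & eval s e < W :
    exec W (Store a e) s (ecost a + ecost e).+1
      (MState (regs s) (upd (mem s) (eval s a) (eval s e)) (out s))
| XOut s e of eval s e < W :
    exec W (Out e) s (ecost e).+1
      (MState (regs s) (mem s) (rcons (out s) (eval s e)))
| XSeq s s1 s2 c1 c2 t1 t2 of exec W c1 s t1 s1 & exec W c2 s1 t2 s2 :
    exec W (Seq c1 c2) s (t1 + t2) s2
| XIfT s s1 b c1 c2 t of teval s b & exec W c1 s t s1 :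
    exec W (If b c1 c2) s (tcost b + t).+1 s1
| XIfF s s1 b c1 c2 t of ~~ teval s b & exec W c2 s t s1 :
    exec W (If b c1 c2) s (tcost b + t).+1 s1
| XWhileT s s1 s2 b c t1 t2 of
    teval s b & exec W c s t1 s1 & exec W (While b c) s1 t2 s2 :
    exec W (While b c) s (tcost b + t1 + t2).+1 s2
| XWhileF s b c of ~~ teval s b :
    exec W (While b c) s (tcost b).+1 s.

Definition minit (input : seq nat) : mstate :=
  MState (fun=> 0) (nth 0 input) [::].

(* The program [c], on [input], halts with output [output] within [t] steps on
   words smaller than [W]. *)
Definition computes (W : nat) (c : cmd) (input : seq nat) (t : nat)
    (output : seq nat) : Prop :=
  exists t' s', [/\ exec W c (minit input) t' s', t' <= t & out s' = output].

(** ** Encodings *)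

Section InputEncoding.
Variable n : nat.
Notation V := 'I_n.

(* Parts are named by numbers: the singleton {v} by v, and the part created by
   the k-th merge (k = 0, 1, ...) by n + k.  In a construction sequence every
   merge creates a new set, so [index] retrieves the name of a part. *)
Definition merged (o : cop V) : option {set V} :=
  if o is Merge A B then Some (A :|: B) else None.

Definition part_table (ops : seq (cop V)) : seq {set V} :=
  [seq [set v] | v <- enum V] ++ pmap merged ops.

Definition encode_op (tab : seq {set V}) (o : cop V) : seq nat :=
  match o with
  | Merge A B => [:: 0; index A tab; index B tab]
  | PosResolve A B => [:: 1; index A tab; index B tab]
  | NegResolve A B => [:: 2; index A tab; index B tab]
  end.

Definition encode_ops (ops : seq (cop V)) : seq nat :=
  [:: n, size ops & flatten (map (encode_op (part_table ops)) ops)].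

End InputEncoding.

Section OutputEncoding.
Variables n m : nat.

Definition pair_set (x : bool * ('I_m * 'I_m)) : {set 'I_m} :=
  [set x.2.1; x.2.2].

(* [L] lists each pair of A (tagged false) and of B (tagged true) once. *)
Definition lists_pairs (L : seq (bool * ('I_m * 'I_m)))
    (M : signed_tree_model 'I_m) : Prop :=
  [/\ uniq (map pair_set L),
      forall P, (P \in stm_A M) = (P \in [seq pair_set x | x <- L & ~~ x.1]) &
      forall P, (P \in stm_B M) = (P \in [seq pair_set x | x <- L & x.1])].

(* Number of nodes, parent array (the root is its own parent), leaf of each
   vertex, number of pairs, list of signed pairs. *)
Definition encodes_model (output : seq nat) (M : signed_tree_model 'I_m)
    (lf : 'I_n -> 'I_m) : Prop :=
  exists2 L, lists_pairs L M &
    output =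
      m :: [seq val (parent (stm_tree M) u) | u <- enum 'I_m]
        ++ [seq val (lf v) | v <- enum 'I_n]
        ++ size L ::
           flatten [seq [:: nat_of_bool x.1; val x.2.1; val x.2.2] | x <- L].

End OutputEncoding.

(* Main.v *)
Require Import Defs.
From mathcomp Require Import all_boot zify.
Import Defs.

Set Implicit Arguments.
Unset Strict Implicit.
Unset Printing Implicit Defensive.

(** After completing the sequence by further merges, the merges form a full
    binary tree T whose nodes are the parts.  For every operation on two distinct
    parts A, B, merges included, take the pair AB of T: a resolve gives it its own
    sign, a merge the sign of the first later resolve of a part with itself that
    contains A and B (negative if there is none).  If the same pair occurs several
    times, its first occurrence decides.  Nodes are numbered in order of creation,
    and a part dies when its parent is created; two parts that are alive at the
    same time are therefore incomparable in T, and pairs of simultaneously alive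
    parts do not cross.  For two leaves, the pairs of T above them are met in the
    order of the operations, from bottom to top, so the covering pair is the first
    one, and its sign is that of the first resolve applying to the two vertices.
    There are at most n - 1 merges and p resolves.

    In linear time, a forward pass builds the tree, a backward pass computes the
    signs of the merges and distributes the pairs to buckets by their smaller
    node, and one traversal of the buckets removes duplicates by stamping the
    larger nodes. *)

(** * Replaying a numeric operation sequence *)

(* An operation is [(t, (a, b))] with [t] = 0 for a merge, 1 for a positive and
   2 for a negative resolve.  Parts are nodes: a vertex is its own number and
   the k-th merge creates the node [n + k]; parent 0 means "no parent yet". *)
Local Notation nop := (nat * (nat * nat))%type.
Local Notation nop0 := (0, (0, 0)).

Definition nop_code (o : nop) : seq nat := [:: o.1; o.2.1; o.2.2].

Definition ropn (o : nop) y x :=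
  if (o.1 == 0) && ((x == o.2.1) || (x == o.2.2)) then y else x.

Definition pmatch (o : nop) x y :=
  (x == o.2.1) && (y == o.2.2) || (x == o.2.2) && (y == o.2.1).

(* The type of the first resolve of [Q] between the parts containing the nodes
   [x] and [y], with 0 for "none"; [y0] names the next merged part. *)
Fixpoint stat (Q : seq nop) (y0 x y : nat) : nat :=
  if Q is o :: Q' then
    if o.1 == 0 then stat Q' y0.+1 (ropn o y0 x) (ropn o y0 y)
    else if pmatch o x y then o.1 else stat Q' y0 x y
  else 0.

(** The completing merges contain no resolve, so adjacency can still be read off the completed
    sequence. *)
Lemma stat_cat_merges Q X y0 x y : all (fun o : nop => o.1 == 0) X ->
  stat (Q ++ X) y0 x y = stat Q y0 x y.
Proof.
move=> H; elim: Q y0 x y => [|o Q IH] y0 x y /=; last by rewrite !IH.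
by elim: X H y0 x y => [//|o X IH] /= /andP[-> /IH].
Qed.

Section Replay.
Variable n : nat.

Definition nstep (st : (nat -> nat) * nat) (o : nop) :=
  if o.1 == 0 then (upd (upd st.1 o.2.1 st.2) o.2.2 st.2, st.2.+1) else st.

Definition replay (Q : seq nop) := foldl nstep (fun=> 0, n) Q.
Definition npar Q x := (replay Q).1 x.
Definition nnext Q := (replay Q).2.
(** Zero is a safe mark for a missing parent: parents are merged nodes, numbered from [n] on, and
    [n] will be positive. *)
Definition alive Q x := (x < nnext Q) && (npar Q x == 0).

Definition okop Q (o : nop) :=
  [&& o.1 <= 2, alive Q o.2.1, alive Q o.2.2 & (o.1 == 0) ==> (o.2.1 != o.2.2)].

Definition valid (Q : seq nop) :=
  forall i, i < size Q -> okop (take i Q) (nth nop0 Q i).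

Lemma nnext_rcons Q o : nnext (rcons Q o) = nnext Q + (o.1 == 0).
Proof.
rewrite /nnext /replay foldl_rcons /nstep.
by case: eqP => _ /=; rewrite ?addn1 ?addn0.
Qed.

Lemma npar_rcons Q o x : npar (rcons Q o) x =
  if (o.1 == 0) && ((x == o.2.1) || (x == o.2.2)) then nnext Q else npar Q x.
Proof.
rewrite /npar /nnext /replay foldl_rcons /nstep.
by case: (o.1 == 0) => //=; rewrite /upd; case: (x == o.2.2); case: (x == o.2.1).
Qed.

Lemma valid_rcons Q o : valid (rcons Q o) <-> valid Q /\ okop Q o.
Proof.
split=> [V|[V H] i].
  split=> [i iQ|].
    have := V i; rewrite size_rcons nth_rcons iQ -cats1 takel_cat; last lia.
    by apply; lia.
  have := V (size Q); rewrite size_rcons nth_rcons ltnn eqxx.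
  by rewrite -cats1 take_size_cat //; apply; lia.
rewrite size_rcons nth_rcons => iQ; case: ltnP => iQ'.
  by rewrite -cats1 takel_cat; [exact: V | lia].
have -> : i = size Q by lia.
by rewrite eqxx -cats1 take_size_cat.
Qed.

Lemma valid_nil : valid [::].
Proof. by []. Qed.

Lemma valid_catl Q X : valid (Q ++ X) -> valid Q.
Proof.
elim/last_ind: X => [|X o IH]; first by rewrite cats0.
by rewrite -rcons_cat => /valid_rcons[/IH].
Qed.

Lemma nnext_catl Q X : nnext Q <= nnext (Q ++ X).
Proof.
elim/last_ind: X => [|X o IH]; first by rewrite cats0.
by rewrite -rcons_cat nnext_rcons; lia.
Qed.

Lemma nnext_ge Q : n <= nnext Q.
Proof. exact: (nnext_catl [::] Q). Qed.

Lemma alive_lt Q x : alive Q x -> x < nnext Q.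
Proof. by case/andP. Qed.

Lemma alive0 x : alive [::] x = (x < n).
Proof. by rewrite /alive /npar /nnext /= andbT. Qed.

Lemma npar_bounds Q x : valid Q -> npar Q x != 0 ->
  [/\ x < npar Q x, n <= npar Q x & npar Q x < nnext Q].
Proof.
elim/last_ind: Q => [//|Q o IH] /valid_rcons[V /and4P[_ A B _]].
rewrite npar_rcons nnext_rcons; have := nnext_ge Q.
case: ifP => [/andP[-> H]|_ ? nz]; last by have [] := IH V nz; split; lia.
move=> ? _; split; try lia.
by case/orP: H => /eqP->; apply: alive_lt.
Qed.

Lemma npar_new Q x : valid Q -> nnext Q <= x -> npar Q x = 0.
Proof. by move=> V H; apply: contraTeq H => /(npar_bounds V)[]; lia. Qed.


Hypothesis n_gt0 : 0 < n.

Lemma npar_children Q y : valid Q -> n <= y < nnext Q ->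
  exists a b, [/\ a != b, a < y, b < y &
    forall x, (npar Q x == y) = (x == a) || (x == b)].
Proof.
elim/last_ind: Q => [|Q o IH]; first by rewrite /nnext /=; lia.
move=> /valid_rcons[V /and4P[_ A B D]]; rewrite nnext_rcons => yb.
have [ym|yl] : (o.1 == 0) /\ y = nnext Q \/ y < nnext Q by lia.
  case: ym => o0 ->; exists o.2.1, o.2.2; rewrite o0 in D; split=> //; try exact: alive_lt.
  move=> x; rewrite npar_rcons o0 /=; case: ifP => [_|_]; first by rewrite eqxx.
  have [->|/(npar_bounds V)[]] := eqVneq (npar Q x) 0; last lia.
  by have := alive_lt A; lia.
have [] := IH V; first lia.
move=> a [b [ab al bl E]]; exists a, b; split=> // x.
rewrite npar_rcons; case: ifP => [/andP[_ H]|_ //]; rewrite -E.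
have -> : npar Q x = 0 by case/orP: H => /eqP->; [case/andP: A | case/andP: B] => _ /eqP.
lia.
Qed.

Lemma alive_rcons Q o x : valid Q -> okop Q o -> alive (rcons Q o) x =
  if o.1 == 0 then (x == nnext Q) || [&& x != o.2.1, x != o.2.2 & alive Q x]
  else alive Q x.
Proof.
move=> V /and4P[_ A B _]; rewrite /alive nnext_rcons npar_rcons.
case: eqP => _ /=; last by rewrite addn0.
have := npar_new V (leqnn _); have := alive_lt A; have := alive_lt B.
case: (ltngtP x (nnext Q)) => [xl||->] /=; try lia.
  rewrite addn1 ltnS (ltnW xl) /=.
  by case: (x == o.2.1); case: (x == o.2.2) => /=; lia.
move=> l1 l2 ->; rewrite addn1 leqnn /=.
by rewrite ifF //; lia.
Qed.

(** A merge kills two nodes and creates one, so the number of alive nodes plus the number of created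
    nodes is invariant. Initially both are [n]. *)
Lemma alive_count Q : valid Q -> exists L : seq nat,
  [/\ uniq L, forall x, (x \in L) = alive Q x & size L + nnext Q = n.*2].
Proof.
elim/last_ind: Q => [|Q o IH].
  exists (iota 0 n); split; first exact: iota_uniq.
    by move=> x; rewrite alive0 mem_iota.
  by rewrite size_iota /nnext /= addnn.
move=> /valid_rcons[V ok]; have [L [uL ML sL]] := IH V.
have AR := fun x => alive_rcons x V ok; rewrite nnext_rcons.
have /and4P[_ A B D] := ok.
case: eqP => o0 in AR D *; last first.
  by exists L; split=> // [x|]; [rewrite AR | lia].
exists (nnext Q :: rem o.2.2 (rem o.2.1 L)).
have uL1 := rem_uniq o.2.1 uL.
have bL : o.2.2 \in rem o.2.1 L by rewrite mem_rem_uniq // inE ML B eq_sym andbT.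
split.
- rewrite /= rem_uniq // andbT mem_rem_uniq // inE mem_rem_uniq // inE ML /alive ltnn.
  by rewrite !andbF.
- move=> x; rewrite AR inE mem_rem_uniq // inE mem_rem_uniq // inE ML; congr (_ || _).
  by rewrite andbCA.
- have aL : o.2.1 \in L by rewrite ML.
  have : 0 < size (rem o.2.1 L) by case: (rem _ _) bL.
  have : 0 < size L by case: (L) aL.
  by move: sL; rewrite /= !size_rem //; move: (size L) => k; lia.
Qed.

(** The node created last has no parent yet, since parents have larger numbers; hence at least one
    node is alive in the count. *)
Lemma nnext_lt Q : valid Q -> nnext Q < n.*2.
Proof.
move=> V; have [L [uL ML sL]] := alive_count V.
have : nnext Q - 1 \in L.
  have nn := nnext_ge Q.
  rewrite ML /alive; apply/andP; split; first lia.
  by apply/negPn/negP => /(npar_bounds V)[]; lia.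
by case: (L) sL => //=; lia.
Qed.

Lemma nnext_count Q : nnext Q = n + count (fun o : nop => o.1 == 0) Q.
Proof.
elim/last_ind: Q => [|Q o IH]; first by rewrite addn0.
by rewrite nnext_rcons IH -cats1 count_cat /= addn0 addnA.
Qed.

(** Only alive nodes receive a parent, so a parent is never overwritten. *)
Lemma npar_catl Q X x : valid (Q ++ X) -> npar Q x != 0 -> npar (Q ++ X) x = npar Q x.
Proof.
elim/last_ind: X => [|X o IH]; first by rewrite cats0.
rewrite -rcons_cat => /valid_rcons[V /and4P[_ A B _]] nz.
rewrite npar_rcons IH //; case: ifP => // /andP[_ /orP[]/eqP E].
  by case/andP: A; rewrite -E IH // (negbTE nz).
by case/andP: B; rewrite -E IH // (negbTE nz).
Qed.

Lemma npar_cat_alive Q X x : valid (Q ++ X) -> npar Q x == 0 ->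
  npar (Q ++ X) x != 0 -> nnext Q <= npar (Q ++ X) x.
Proof.
elim/last_ind: X => [|X o IH]; first by rewrite cats0 => _ ->.
rewrite -rcons_cat => /valid_rcons[V _] z; rewrite npar_rcons.
by case: ifP => _; [rewrite nnext_catl | exact: IH].
Qed.

(** * The tree of a completed sequence *)

Section Final.
Variable Q : seq nop.
Hypothesis V : valid Q.
Let m := (n.-1).*2.+1.
Hypothesis Qm : nnext Q = m.

(** The last node created is the root. It has no parent in [npar], whereas the tree format makes it
    its own parent. *)
Definition fpar x := if x == m.-1 then m.-1 else npar Q x.

(** Once [2n - 1] nodes exist, the count leaves exactly one alive node, and the last one created is
    alive. *)
Lemma root_only x : alive Q x -> x = m.-1.
Proof.
move=> Ax; have [L [uL ML sL]] := alive_count V.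
have r : m.-1 \in L.
  rewrite ML /alive Qm; apply/andP; split; first lia.
  by apply/negPn/negP => /(npar_bounds V)[]; lia.
move: Ax; rewrite -ML; case: L r sL {uL ML} => [//|y [|z L]] /=; last lia.
by rewrite !inE => /eqP<- _ /eqP.
Qed.

Lemma fpar_gt x : x < m.-1 -> x < fpar x < m.
Proof.
move=> xm; rewrite /fpar; case: eqP => [|_]; first lia.
have : npar Q x != 0.
  apply/negP => z; have : alive Q x by rewrite /alive z Qm; lia.
  by move/root_only; lia.
by move/(npar_bounds V) => []; rewrite Qm; lia.
Qed.

Lemma fpar_lt x : x < m -> fpar x < m.
Proof.
move=> xm; have [/fpar_gt|h] := ltnP x m.-1; first lia.
by rewrite /fpar ifT; lia.
Qed.

Lemma valid_take i : valid (take i Q).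
Proof. by apply: (@valid_catl _ (drop i Q)); rewrite cat_take_drop. Qed.

Lemma nnext_take_le i : nnext (take i Q) <= m.
Proof. by rewrite -Qm -{2}(cat_take_drop i Q) nnext_catl. Qed.

Lemma nnext_takeS i : i < size Q ->
  nnext (take i.+1 Q) = nnext (take i Q) + ((nth nop0 Q i).1 == 0).
Proof. by move=> iQ; rewrite (take_nth nop0 iQ) nnext_rcons. Qed.

(** A node still alive before operation [i] gets its parent from operation [i] or a later one, hence
    a number not yet used at that time. *)
Lemma fpar_alive i x : alive (take i Q) x -> x < m.-1 -> nnext (take i Q) <= fpar x.
Proof.
case/andP=> _ z xm; have := fpar_gt xm; rewrite /fpar; case: eqP => [|_]; first lia.
move=> h; rewrite -{2}(cat_take_drop i Q); apply: npar_cat_alive => //.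
  by rewrite cat_take_drop.
by rewrite cat_take_drop; lia.
Qed.

Definition nanc u x := exists k, iter k fpar x = u.

Lemma nanc_refl x : nanc x x.
Proof. by exists 0. Qed.

Lemma nanc_par x : nanc (fpar x) x.
Proof. by exists 1. Qed.

Lemma nanc_trans u v w : nanc u v -> nanc v w -> nanc u w.
Proof. by move=> [k <-] [l <-]; exists (k + l); rewrite iterD. Qed.

Lemma nanc_bounds u x : nanc u x -> x < m -> x <= u < m.
Proof.
case=> k <- xm; elim: k => [|k IH] /=; first lia.
set y := iter k fpar x in IH *; have := @fpar_lt y.
have [/fpar_gt|h] := ltnP y m.-1; first lia.
by rewrite /fpar ifT; lia.
Qed.

Lemma nanc_strict u x : nanc u x -> u != x -> x < m -> x < m.-1 /\ nanc u (fpar x).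
Proof.
case=> [[|k]] /= E ux xm; first by rewrite E eqxx in ux.
split; last by exists k; rewrite -iterSr.
by have := @nanc_bounds u x (ex_intro _ k.+1 E) xm; lia.
Qed.

Lemma nanc_anti u x : x < m -> nanc u x -> nanc x u -> u = x.
Proof. by move=> xm a b; have := nanc_bounds a xm; have := nanc_bounds b; lia. Qed.

Lemma nanc_total u v x : nanc u x -> nanc v x -> nanc u v \/ nanc v u.
Proof.
move=> [k <-] [l <-]; have [kl|lk] := leqP k l.
  by right; exists (l - k); rewrite -iterD subnK.
by left; exists (k - l); rewrite -iterD subnK // ltnW.
Qed.

(* A strict descendant of a node dies no later than that node is born. *)
Lemma alive_anc i u w : alive (take i Q) u -> alive (take i Q) w -> nanc u w -> u = w.
Proof.
move=> Au Aw a; apply/eqP/negPn/negP => uw.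
have wm : w < m by have := alive_lt Aw; have := nnext_take_le i; lia.
have [wm' a'] := nanc_strict a uw wm.
have := fpar_alive Aw wm'; have := alive_lt Au.
by have := nanc_bounds a' (fpar_lt wm); lia.
Qed.

Notation opn i := (nth nop0 Q i).
Notation nx i := (nnext (take i Q)).

(* The part containing [x] before operation [i]. *)
Fixpoint rep i x := if i is i'.+1 then ropn (opn i') (nx i') (rep i' x) else x.

Lemma merge_par i : i < size Q -> (opn i).1 = 0 ->
  fpar (opn i).2.1 = nx i /\ fpar (opn i).2.2 = nx i.
Proof.
move=> iQ t0; have /and4P[_ A B _] := V iQ.
have nxm : nx i < m.
  by have := nnext_take_le i.+1; rewrite nnext_takeS // t0; lia.
have nx0 : nx i != 0 by have := nnext_ge (take i Q); lia.
have E x : (x == (opn i).2.1) || (x == (opn i).2.2) -> x < nx i -> fpar x = nx i.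
  move=> xo xl; rewrite /fpar; case: eqP => [|_]; first lia.
  have np : npar (take i.+1 Q) x = nx i.
    by rewrite (take_nth nop0 iQ) npar_rcons t0 /= xo.
  rewrite -np -{1}(cat_take_drop i.+1 Q); apply: npar_catl; last by rewrite np.
  by rewrite cat_take_drop.
by split; apply: E; rewrite ?eqxx ?orbT // alive_lt.
Qed.

Lemma rep_alive i x : x < n -> i <= size Q -> alive (take i Q) (rep i x).
Proof.
move=> xn; elim: i => [|i IH] iQ; first by rewrite take0 alive0.
have Ai := IH (ltnW iQ); rewrite (take_nth nop0 iQ) /= /ropn.
rewrite alive_rcons //; [|exact: valid_take|exact: V].
case: eqP => //= _; case: ifP => [_|/norP[E1 E2]]; first by rewrite eqxx.
by rewrite E1 E2 Ai orbT.
Qed.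

Lemma rep_ancS i x : i < size Q -> nanc (rep i.+1 x) (rep i x).
Proof.
move=> iQ; rewrite /= /ropn; case: ifP => [/andP[/eqP t0 /orP[]/eqP->]|_].
- by have [<- _] := merge_par iQ t0; exact: nanc_par.
- by have [_ <-] := merge_par iQ t0; exact: nanc_par.
exact: nanc_refl.
Qed.

Lemma rep_anc i j x : i <= j <= size Q -> nanc (rep j x) (rep i x).
Proof.
elim: j => [|j IH] ij; first by have -> : i = 0 by [lia]; exact: nanc_refl.
have [->|ne] := eqVneq i j.+1; first exact: nanc_refl.
by apply: nanc_trans (rep_ancS x _) (IH _); lia.
Qed.

(** Both [u] and [rep i x] are alive ancestors of [x]. Ancestors of one node form a chain, and
    comparable alive nodes are equal. *)
Lemma alive_rep i x u : x < n -> i <= size Q -> alive (take i Q) u -> nanc u x ->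
  u = rep i x.
Proof.
move=> xn iQ Au ux; have Ar := rep_alive xn iQ.
have rx : nanc (rep i x) x by apply: (@rep_anc 0); lia.
by case: (nanc_total ux rx) => [/(alive_anc Au Ar)|/(alive_anc Ar Au)].
Qed.


(* A merge stands for the pair of its two children, signed by the first later
   resolve of a part with itself that contains them. *)
Definition sgn i := if (opn i).1 == 0
  then stat (drop i.+1 Q) (nx i).+1 (nx i) (nx i) else (opn i).1.

(** A resolve of a part with itself contributes no transversal pair. *)
Definition sel i := (opn i).2.1 != (opn i).2.2.

Definition kept i := sel i &&
  all (fun j => ~~ pmatch (opn i) (opn j).2.1 (opn j).2.2) (iota 0 i).

(** * The first operation that meets two given vertices *)

Section Pair.
Variables a b : nat.
Hypotheses (an : a < n) (bn : b < n) (ab : a != b).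

(** Until an operation acts on the two parts containing [a] and [b], no resolve decides the pair and
    no merge unites the parts, so [stat] merely follows them. *)
Lemma stat_rep j : j <= size Q ->
  (forall i, i < j -> ~~ pmatch (opn i) (rep i a) (rep i b)) ->
  stat Q n a b = stat (drop j Q) (nx j) (rep j a) (rep j b) /\ rep j a != rep j b.
Proof.
elim: j => [|j IH] jQ H; first by rewrite drop0 take0.
have [|-> ne] := IH (ltnW jQ); first by move=> i ij; apply: H; lia.
have := H j (ltnSn j); rewrite (drop_nth nop0 jQ) nnext_takeS //=.
have Aa := rep_alive an (ltnW jQ); have Ab := rep_alive bn (ltnW jQ).
have := alive_lt Aa; have := alive_lt Ab; move: ne; rewrite /pmatch /ropn.
case: ((opn j).1 == 0) => /=; last by move=> ? _ _ /negbTE ->; rewrite addn0.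
rewrite addn1 => ne la lb nm; split=> //.
(* If both parts were merged here, the operation would match; if only one was, its new number [nx j]
   differs from all older ones. *)
case: ifP => ha; case: ifP => hb; try lia.
Qed.

(** A matching resolve decides at once. After a matching merge both vertices lie in the new part,
    and the first self-resolve around it decides, which is how merges are signed. *)
Lemma stat_match e : e < size Q -> pmatch (opn e) (rep e a) (rep e b) ->
  (forall i, i < e -> ~~ pmatch (opn i) (rep i a) (rep i b)) ->
  stat Q n a b = sgn e /\ sel e.
Proof.
move=> eQ me H; have [-> ne] := stat_rep (ltnW eQ) H.
rewrite (drop_nth nop0 eQ) /= me /sgn /sel; split; last by move: me ne; rewrite /pmatch; lia.
case: eqP => // t0; rewrite /ropn t0 /=.
move: me; rewrite /pmatch => me.
by rewrite !ifT //; lia.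
Qed.

(** Without a match the two parts would stay distinct to the end, but then only the root is
    alive. *)
Lemma match_exists : exists e, [/\ e < size Q, pmatch (opn e) (rep e a) (rep e b) &
  forall i, i < e -> ~~ pmatch (opn i) (rep i a) (rep i b)].
Proof.
have [/hasP[e0 he0 me0]|/hasPn no] :=
  boolP (has (fun e => pmatch (opn e) (rep e a) (rep e b)) (iota 0 (size Q))); last first.
  have [] := stat_rep (leqnn _); first by move=> i ij; apply: no; rewrite mem_iota.
  have ra := rep_alive an (leqnn _); have rb := rep_alive bn (leqnn _).
  move: ra rb; rewrite take_size => /root_only -> /root_only ->.
  by rewrite eqxx.
have ex : exists e, (e < size Q) && pmatch (opn e) (rep e a) (rep e b).
  by exists e0; rewrite me0 andbT; move: he0; rewrite mem_iota.
case: (ex_minnP ex) => e /andP[eQ me] mn; exists e; split=> // i ie.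
by apply/negP => mi; have := mn i; rewrite mi; lia.
Qed.

End Pair.

Definition ends i : seq nat := [:: (opn i).2.1; (opn i).2.2].

(** The ends of one operation are alive together, so each is older than the parent of the other.
    This inequality and [sanc_fpar] reduce transversality and non-crossing to arithmetic on node
    numbers. *)
Lemma coexist i x y : i < size Q -> sel i -> x \in ends i -> y \in ends i ->
  x < m.-1 /\ x < fpar y.
Proof.
move=> iQ si xi yi; have /and4P[_ A B _] := V iQ.
have al z : z \in ends i -> alive (take i Q) z by rewrite !inE => /orP[]/eqP->.
have lm := nnext_take_le i.
have E u v : u != v -> alive (take i Q) u -> alive (take i Q) v -> u < m.-1.
  move=> uv Au Av; apply/negPn/negP => um.
  have := alive_lt Au; have := alive_lt Av => lu lv.
  have := fpar_alive Av; have := @fpar_gt v; lia.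
have F z : z \in ends i -> z < m.-1.
  rewrite !inE => /orP[]/eqP->; [apply: (E _ _ si) | apply: (E _ (opn i).2.1)] => //.
  by rewrite eq_sym.
split; first exact: F.
by apply: leq_trans (fpar_alive (al y yi) (F y yi)); apply/alive_lt/al.
Qed.

Lemma sanc_fpar x y : y < m -> nanc x y -> x != y -> fpar y <= x.
Proof.
move=> ym a ne; have [_ /nanc_bounds h] := nanc_strict a ne ym.
by have := h (fpar_lt ym); lia.
Qed.

End Final.
End Replay.

(** * The signed tree model *)

Lemma set2_eq (T : finType) (x y u v : T) : [set x; y] = [set u; v] ->
  (x = u /\ y = v) \/ (x = v /\ y = u).
Proof.
move=> E.
have := set21 x y; have := set22 x y; rewrite E !inE => yE xE.
have := set21 u v; have := set22 u v; rewrite -E !inE => vE uE.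
case/orP: xE uE vE yE => /eqP xE /orP[]/eqP uE /orP[]/eqP vE /orP[]/eqP yE; subst; auto.
Qed.

Section Model.
Variables (n : nat) (Q : seq nop).
Hypotheses (n_gt0 : 0 < n) (V : valid n Q).
Notation m := (n.-1).*2.+1.
Hypothesis Qm : nnext n Q = m.
Notation opn i := (nth nop0 Q i).
Notation nx i := (nnext n (take i Q)).

Definition oparent (u : 'I_m) : 'I_m := inord (fpar n Q u).

Lemma val_oparent u : val (oparent u) = fpar n Q u.
Proof. by rewrite /= inordK //; apply: fpar_lt. Qed.

Lemma val_iter_oparent k u : val (iter k oparent u) = iter k (fpar n Q) u.
Proof. by elim: k => //= k <-; exact: val_oparent. Qed.

Lemma oparent_root : oparent ord_max = ord_max.
Proof. by apply: val_inj; rewrite val_oparent /fpar /= eqxx. Qed.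

Lemma oroot_reached x : exists k, iter k oparent x = ord_max.
Proof.
have [d] := ubnP (m - x); elim: d x => // d IH x xd.
have [xm|xm] := ltnP x m.-1; last first.
  by exists 0; apply: val_inj => /=; have := ltn_ord x; lia.
have [|k E] := IH (oparent x); last by exists k.+1; rewrite iterSr.
by rewrite val_oparent; have := fpar_gt n_gt0 V Qm xm; lia.
Qed.

Definition otree : rtree 'I_m := RTree oparent_root oroot_reached.

Lemma ancE u v : anc otree u v <-> nanc n Q u v.
Proof.
split=> [[k <-]|[k E]]; first by exists k; rewrite -val_iter_oparent.
by exists k; apply: val_inj; rewrite val_iter_oparent.
Qed.

Lemma ochildrenE (x y : 'I_m) :
  (x \in children otree y) = (x < m.-1) && (npar n Q x == y).
Proof.
rewrite inE -!val_eqE /= inordK ?fpar_lt // /fpar.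
by have := ltn_ord x; case: eqP; lia.
Qed.

Lemma ochildren (y : 'I_m) : (y < n -> children otree y = set0) /\
   (n <= y -> #|children otree y| = 2).
Proof.
split=> yn.
  apply/setP => x; rewrite ochildrenE inE; apply/negP => /andP[xm /eqP E].
  have nz : npar n Q x != 0.
    by have := fpar_gt n_gt0 V Qm xm; rewrite /fpar ifF; lia.
  by have [] := npar_bounds V nz; lia.
have [|a [b [ab al bl E]]] := @npar_children n n_gt0 Q y V.
  by rewrite Qm yn ltn_ord.
have ym := ltn_ord y.
have va : val (inord a : 'I_m) = a by rewrite /= inordK //; lia.
have vb : val (inord b : 'I_m) = b by rewrite /= inordK //; lia.
have -> : children otree y = [set inord a; inord b].
  apply/setP => x; rewrite ochildrenE E !inE -!val_eqE va vb /=.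
  by apply/andP/idP => [[]//|h]; split=> //; lia.
by rewrite cards2 -val_eqE va vb ab.
Qed.

Lemma otree_full : full_binary otree.
Proof.
move=> y; have [/(proj1 (ochildren y))->|/(proj2 (ochildren y))] := ltnP y n.
  by left; rewrite cards0.
by right.
Qed.

Lemma otree_leaf (y : 'I_m) : is_leaf otree y = (y < n).
Proof.
rewrite /is_leaf; have [/(proj1 (ochildren y))->|/(proj2 (ochildren y)) c] := ltnP y n.
  exact: eqxx.
by apply/eqP => E; rewrite E cards0 in c.
Qed.

Definition oends i : {set 'I_m} := [set inord (opn i).2.1; inord (opn i).2.2].

Lemma ends_lt i x : i < size Q -> x \in ends Q i -> x < m.
Proof.
move=> iQ xi; have /and4P[_ /alive_lt A /alive_lt B _] := V iQ.
have := nnext_take_le Qm i; move: xi; rewrite !inE.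
by case/orP => /eqP ->; lia.
Qed.

Lemma val_ends i x : i < size Q -> x \in ends Q i -> val (inord x : 'I_m) = x.
Proof. by move=> iQ xi; rewrite /= inordK //; apply: ends_lt xi. Qed.

Lemma oendsP i (x : 'I_m) : i < size Q -> (x \in oends i) = (val x \in ends Q i).
Proof.
by move=> iQ; rewrite !inE -!val_eqE !(@val_ends i) // !inE eqxx ?orbT.
Qed.

Lemma oends_set2 i (u v : 'I_m) : i < size Q -> oends i = [set u; v] <->
  pmatch (opn i) u v.
Proof.
move=> iQ; rewrite /pmatch.
have v1 := @val_ends i (opn i).2.1 iQ; have v2 := @val_ends i (opn i).2.2 iQ.
rewrite !inE !eqxx orbT in v1 v2.
split=> [/set2_eq[[<- <-]|[<- <-]]|].
- by rewrite v1 // v2 // !eqxx.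
- by rewrite v1 // v2 // !eqxx orbT.
case/orP=> /andP[/eqP uE /eqP vE].
  by congr [set _; _]; apply: val_inj; rewrite ?v1 ?v2.
by rewrite setUC; congr [set _; _]; apply: val_inj; rewrite ?v1 ?v2.
Qed.

Definition entry i : bool * ('I_m * 'I_m) :=
  (sgn n Q i == 1, (inord (opn i).2.1, inord (opn i).2.2)).

Definition entries := [seq entry i | i <- iota 0 (size Q) & kept Q i].

Lemma keptP i : kept Q i -> i < size Q ->
  sel Q i /\ forall j, j < i -> oends i <> oends j.
Proof.
case/andP=> si /allP H iQ; split=> // j ji /esym/esym E.
have jQ : j < size Q by lia.
have := H j; rewrite mem_iota => /(_ ji).
have v1 := @val_ends j (opn j).2.1 jQ; have v2 := @val_ends j (opn j).2.2 jQ.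
rewrite !inE !eqxx orbT in v1 v2.
by move/oends_set2: E => /(_ iQ); rewrite v1 // v2 // => ->.
Qed.

Lemma kept_inj i j : i < size Q -> j < size Q -> kept Q i -> kept Q j ->
  oends i = oends j -> i = j.
Proof.
move=> iQ jQ ki kj E; case: (ltngtP i j) => // ij.
  by case: ((keptP kj jQ).2 i ij).
by case: ((keptP ki iQ).2 j ij).
Qed.

(** The filter is a parameter so that [negb] and [id] yield the negative and the positive pairs. *)
Lemma entriesP (f : bool -> bool) P :
  reflect (exists i, [/\ i < size Q, kept Q i, f (sgn n Q i == 1) & P = oends i])
          (P \in [seq pair_set x | x <- entries & f x.1]).
Proof.
apply: (iffP mapP) => [[x]|[i [iQ ki fi ->]]].
  rewrite mem_filter => /andP[fx /mapP[i]]; rewrite mem_filter mem_iota => /andP[ki iQ].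
  by move=> E ->; exists i; rewrite E in fx *.
exists (entry i) => //; rewrite mem_filter fi; apply/mapP; exists i => //.
by rewrite mem_filter ki mem_iota.
Qed.

Definition oA := [set P in [seq pair_set x | x <- entries & ~~ x.1]].
Definition oB := [set P in [seq pair_set x | x <- entries & x.1]].

Lemma oABP P : reflect (exists i, [/\ i < size Q, kept Q i & P = oends i])
  (P \in oA :|: oB).
Proof.
rewrite !inE; apply: (iffP orP).
  by case=> [/(entriesP negb)|/(entriesP id)] [i [iQ ki _ ->]]; exists i.
case=> i [iQ ki ->]; case E : (sgn n Q i == 1);
  [right; apply/(entriesP id) | left; apply/(entriesP negb)];
  by exists i; rewrite E.
Qed.

Lemma oAB_disjoint : [disjoint oA & oB].
Proof.
apply/pred0P => P /=; rewrite !inE; apply/negP => /andP[/(entriesP negb)[i [iQ ki fi ->]]].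
case/(entriesP id) => j [jQ kj fj /(kept_inj iQ jQ ki kj) E].
by rewrite -E in fj; rewrite /= fj in fi.
Qed.

Lemma oAB_transversal P : P \in oA :|: oB -> Defs.transversal otree P.
Proof.
case/oABP=> i [iQ ki ->]; have [si _] := keptP ki iQ.
have i1 : (opn i).2.1 \in ends Q i by rewrite !inE eqxx.
have i2 : (opn i).2.2 \in ends Q i by rewrite !inE eqxx orbT.
have v1 := val_ends iQ i1; have v2 := val_ends iQ i2.
have [l1 c1] := coexist n_gt0 V Qm iQ si i1 i2.
have [l2 c2] := coexist n_gt0 V Qm iQ si i2 i1.
exists (inord (opn i).2.1), (inord (opn i).2.2); split=> //.
- by move=> E; move: si; rewrite /sel -v1 -v2 E eqxx.
- move/ancE; rewrite v1 v2 => /(sanc_fpar n_gt0 V Qm) h.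
  by have := h; move: si; rewrite /sel; lia.
- move/ancE; rewrite v1 v2 => /(sanc_fpar n_gt0 V Qm) h.
  by have := h; move: si; rewrite /sel; lia.
Qed.

(** A crossing would give the cycle [fpar y <= x < fpar y' <= x' < fpar y]: weak steps by ancestry,
    strict steps by coexistence. *)
Lemma oAB_noncrossing P P' : P \in oA :|: oB -> P' \in oA :|: oB -> ~ cross otree P P'.
Proof.
case/oABP=> i [iQ ki ->]; have [si _] := keptP ki iQ.
case/oABP=> j [jQ kj ->]; have [sj _] := keptP kj jQ.
case=> [[x [y [xi yj [/ancE a1 n1]]]] [x' [y' [xj yi [/ancE a2 n2]]]]].
rewrite !oendsP // in xi yj xj yi.
have [_ c1] := coexist n_gt0 V Qm iQ si xi yi.
have [_ c2] := coexist n_gt0 V Qm jQ sj xj yj.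
have h1 := sanc_fpar n_gt0 V Qm (ltn_ord y) a1; have h2 := sanc_fpar n_gt0 V Qm (ltn_ord y') a2.
have : fpar n Q y <= x by apply: h1; apply/eqP => /val_inj.
have : fpar n Q y' <= x' by apply: h2; apply/eqP => /val_inj.
rewrite /= in c1 c2 *; lia.
Qed.

Definition omodel := SignedTreeModel otree_full oAB_disjoint oAB_transversal oAB_noncrossing.

Lemma omodel_lists : lists_pairs entries omodel.
Proof.
split; last first.
- by move=> P; rewrite inE.
- by move=> P; rewrite inE.
rewrite /entries -map_comp map_inj_in_uniq ?filter_uniq ?iota_uniq //.
move=> i j; rewrite !mem_filter !mem_iota => /andP[ki iQ] /andP[kj jQ].
exact: kept_inj.
Qed.

Lemma omodel_pairs : num_pairs omodel <= size Q.
Proof.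
rewrite /num_pairs /= !cardsE.
apply: leq_trans (leq_add (card_size _) (card_size _)) _.
rewrite !size_map !size_filter addnC (count_predC (fun x : bool * ('I_m * 'I_m) => x.1)).
rewrite size_map size_filter.
by apply: leq_trans (count_size _ _) _; rewrite size_iota.
Qed.

Definition oleaf (v : 'I_n) : 'I_m := inord v.

Lemma val_oleaf v : val (oleaf v) = v.
Proof. by rewrite /= inordK //; move: (ltn_ord v); clear -n_gt0; lia. Qed.

(** Let [e] be the first operation on the parts containing [a] and [b]. Its pair lies below every
    other pair above the two leaves, so it alone covers them, and its sign is their status. *)
Lemma omodel_of (G : sgraph 'I_n) :
  (forall a b : 'I_n, a != b -> G a b = (stat Q n a b == 1)) ->
  model_of omodel oleaf G.
Proof.
move=> HG; split.
- by move=> u v /(congr1 val); rewrite !val_oleaf => /val_inj.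
- move=> x; rewrite otree_leaf; split=> [xn|[v <-]]; last by rewrite val_oleaf.
  by exists (Ordinal xn); apply: val_inj; rewrite val_oleaf.
move=> a b /eqP ab; rewrite HG //.
have an := ltn_ord a; have bn := ltn_ord b.
have ab' : (a : nat) != b by [].
have [e [eQ me fe]] := match_exists n_gt0 V Qm an bn ab'.
have [-> se] := stat_match n_gt0 V Qm an bn ab' eQ me fe.
have repm i x : x < n -> i <= size Q -> rep n Q i x < m.
  move=> xn iQ; have := alive_lt (rep_alive n_gt0 V xn iQ).
  by have := nnext_take_le Qm i; lia.
pose u : 'I_m := inord (rep n Q e a); pose v : 'I_m := inord (rep n Q e b).
have vu : val u = rep n Q e a by rewrite /= inordK ?repm // ltnW.
have vv : val v = rep n Q e b by rewrite /= inordK ?repm // ltnW.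
have Ee : oends e = [set u; v] by apply/oends_set2 => //; rewrite vu vv.
(* Ends of an operation that lie above the leaves are alive, hence are the current parts of [a] and
   [b]; minimality of [e] then gives [e <= i]. *)
have above i (u' v' : 'I_m) : i < size Q -> oends i = [set u'; v'] ->
    anc otree u' (oleaf a) -> anc otree v' (oleaf b) ->
    [/\ e <= i, val u' = rep n Q i a & val v' = rep n Q i b].
  move=> iQ Ei /ancE; rewrite val_oleaf => au /ancE; rewrite val_oleaf => bv.
  have /and4P[_ A B _] := V iQ; have := (oends_set2 u' v' iQ).1 Ei => mi.
  have [Au Av] : alive n (take i Q) u' /\ alive n (take i Q) v'.
    by case/orP: mi => /andP[/eqP-> /eqP->].
  have uE := alive_rep n_gt0 V Qm an (ltnW iQ) Au au.
  have vE := alive_rep n_gt0 V Qm bn (ltnW iQ) Av bv.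
  split=> //; rewrite leqNgt; apply/negP => /fe.
  by rewrite -uE -vE mi.
have ua : anc otree u (oleaf a).
  apply/ancE; rewrite vu val_oleaf; apply: (rep_anc n_gt0 V Qm (i := 0)); lia.
have vb : anc otree v (oleaf b).
  apply/ancE; rewrite vv val_oleaf; apply: (rep_anc n_gt0 V Qm (i := 0)); lia.
(* An earlier occurrence of the same pair would also lie above the leaves, before [e]. *)
have ke : kept Q e.
  rewrite /kept se; apply/allP => j; rewrite mem_iota => /= je.
  have jQ : j < size Q by lia.
  apply/negP => mj.
  have Ej : oends j = [set u; v].
    rewrite -Ee; apply/esym/oends_set2 => //.
    have v1 := @val_ends j (opn j).2.1 jQ; have v2 := @val_ends j (opn j).2.2 jQ.
    by rewrite !inE !eqxx orbT in v1 v2; rewrite v1 // v2.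
  by have [] := above j u v jQ Ej ua vb; lia.
have anti (x y : 'I_m) : anc otree x y -> anc otree y x -> x = y.
  by move=> /ancE h1 /ancE h2; apply/val_inj/(nanc_anti n_gt0 V Qm (ltn_ord y)).
split=> [s1|].
  exists (oends e); first by rewrite inE; apply/(entriesP id); exists e.
  split; first by apply/oABP; exists e.
  exists u, v; split=> // -[u'' [v'' [/oABP[i [iQ ki Ei]] ne [uu ua'] [vv' vb']]]].
  have [ei uE vE] := above i u'' v'' iQ (esym Ei) ua' vb'.
  apply: ne; rewrite Ee.
  (* Parts only grow, so a pair lying between that of [e] and the leaves also lies above that of
     [e], and the two coincide. *)
  have ri x : nanc n Q (rep n Q i x) (rep n Q e x) by apply: rep_anc => //; lia.
  have -> : u = u'' by apply: anti uu _; apply/ancE; rewrite vu uE; exact: ri.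
  by have -> : v = v'' by apply: anti vv' _; apply/ancE; rewrite vv vE; exact: ri.
case=> P; rewrite inE => /(entriesP id)[i [iQ ki /= si EP]] [_ [u' [v' [E1 au bv no]]]].
have [ei uE vE] := above i u' v' iQ (etrans (esym EP) E1) au bv.
have [E|ne] := eqVneq (oends e) P; first by rewrite (kept_inj eQ iQ ke ki (etrans E EP)).
(* A covering pair other than that of [e] has the pair of [e] strictly between itself and the
   leaves. *)
case: no; exists u, v; split.
- by rewrite -Ee; apply/oABP; exists e.
- by rewrite -Ee; apply/eqP.
- by split=> //; apply/ancE; rewrite uE vu; apply: rep_anc => //; lia.
- by split=> //; apply/ancE; rewrite vE vv; apply: rep_anc => //; lia.
Qed.

End Model.

(** * Numeric encoding of a construction sequence *)

Section CPath.
Variable V : finType.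
Implicit Types (s : cstate V) (o : cop V) (a b : V) (P : {set {set V}}).

Inductive cpath s : seq (cop V) -> cstate V -> Prop :=
| CPathNil : cpath s [::] s
| CPathCons o ops s1 s2 of cstep s o s1 & cpath s1 ops s2 : cpath s (o :: ops) s2.

Lemma construction_cpath (ss : seq (cstate V)) ops :
  construction_sequence ss ops -> cpath cinit ops (last cinit ss).
Proof.
case=> sz h0 st; rewrite -[X in cpath X]h0.
elim: ops ss sz st {h0} => [|o ops IH] [|s ss] //=.
  by case: ss => //= _ _; constructor.
case: ss => [|s1 ss] //= [sz] st.
have [o' [<-] st0] := st 0 isT.
apply: CPathCons st0 _; rewrite -[s1]/(nth cinit (s1 :: ss) 0); apply: IH => [|i iops].
  by rewrite /= sz.
exact: (st i.+1).
Qed.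

Lemma in_pairs_between (A B : {set V}) a b : a != b ->
  ([set a; b] \in pairs_between A B) =
  (a \in A) && (b \in B) || (a \in B) && (b \in A).
Proof.
move=> ab; apply/imset2P/orP => [[x y xA]|].
  rewrite inE => /andP[yB xy] E.
  have := set21 a b; have := set22 a b; rewrite E !inE => h1 h2.
  case/orP: h2 h1 => /eqP aE /orP[]/eqP bE; subst; rewrite ?eqxx ?xA ?yB // in ab *; auto.
case=> /andP[h1 h2]; first by exists a b; rewrite // inE h2.
by exists b a; rewrite ?inE ?h1 1?eq_sym // setUC.
Qed.

Definition disjoint_parts P :=
  forall A B x, A \in P -> B \in P -> x \in A -> x \in B -> A = B.

Lemma cstep_disjoint s o s1 : cstep s o s1 ->
  disjoint_parts (cparts s) -> disjoint_parts (cparts s1).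
Proof.
case=> //= A B PA PB AB D C1 C2 x; rewrite !inE.
case/orP=> [/eqP->|/and3P[n1 n2 p]] /orP[/eqP->|/and3P[n1' n2' p']] //; rewrite ?inE.
- by case/orP=> h1 h2; [case/eqP: n2'; apply: (D C2 A x) | case/eqP: n1'; apply: (D C2 B x)].
- by move=> h1 /orP[h2|h2]; [case/eqP: n2; apply: (D C1 A x) | case/eqP: n1; apply: (D C1 B x)].
- exact: D.
Qed.

End CPath.

(** * Correspondence between parts and node numbers *)

Section Link.
Variable n : nat.
Notation V := 'I_n.
Implicit Types (s : cstate V) (o : cop V) (Q : seq nop).

Definition nenc (tab : seq {set V}) o : nop :=
  match o with
  | Merge A B => (0, (index A tab, index B tab))
  | PosResolve A B => (1, (index A tab, index B tab))
  | NegResolve A B => (2, (index A tab, index B tab))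
  end.

Lemma encode_opsE (ops : seq (cop V)) : encode_ops ops =
  n :: size ops :: flatten (map nop_code (map (nenc (part_table ops)) ops)).
Proof. by rewrite /encode_ops -map_comp; congr [:: _, _ & flatten _]; apply: eq_map => -[]. Qed.

Lemma nenc_resolves tab (ops : seq (cop V)) :
  count (fun o : nop => o.1 != 0) (map (nenc tab) ops) = num_resolves ops.
Proof. by rewrite count_map; apply: eq_count => -[]. Qed.

(** Every set in the table is nonempty and contained in a current part. Were [A :|: B] already
    listed, the part containing it would meet both [A] and [B], and disjointness would make them
    equal. *)
Lemma merged_uniq s ops s' (tab : seq {set V}) : cpath s ops s' ->
  disjoint_parts (cparts s) -> set0 \notin cparts s ->
  {subset cparts s <= tab} ->
  (forall A, A \in tab -> A != set0 /\ exists2 B, B \in cparts s & A \subset B) ->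
  uniq tab -> uniq (tab ++ pmap (@merged n) ops).
Proof.
move=> p; elim: p tab => {s ops s'} [s|s o ops s1 s2 st _ IH] tab D N0 H1 H2 u.
  by rewrite cats0.
have D1 := cstep_disjoint st D.
case: st D1 IH => [A B PA PB AB|A B _ _|A B _ _] /= D1 IH; try exact: IH.
have nz C : C \in cparts s -> C != set0 by apply: contraTneq => ->.
rewrite -cat_rcons; apply: IH => //=.
- rewrite !inE (negbTE N0) !andbF orbF eq_sym.
  apply/eqP => E; move: (nz A PA); rewrite -subset0 -E subsetUl //.
- move=> C; rewrite mem_rcons !inE => /orP[->//|/and3P[_ _ /H1 ->]].
  by rewrite orbT.
- move=> C; rewrite mem_rcons inE => /orP[/eqP->|/H2[nC [E PE CE]]].
    split; last by exists (A :|: B); rewrite // !inE eqxx.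
    by move: (nz A PA); rewrite -!subset0; apply: contraNN; apply/subset_trans/subsetUl.
  split=> //.
  have [EA|nA] := eqVneq E A; first by exists (A :|: B); rewrite ?inE ?eqxx // -EA subsetU // CE.
  have [EB|nB] := eqVneq E B; first by exists (A :|: B); rewrite ?inE ?eqxx // -EB subsetU // CE orbT.
  by exists E; rewrite // !inE nA nB PE orbT.
rewrite rcons_uniq u andbT; apply/negP => /H2[_ [C PC sub]].
have in_C E : E \in cparts s -> E \subset A :|: B -> E = C.
  move=> PE sE; have /set0Pn[x xE] := nz E PE.
  by apply: (D E C x) => //; apply: (subsetP sub); apply: (subsetP sE).
by case/eqP: AB; rewrite (in_C A) ?subsetUl // (in_C B) ?subsetUr.
Qed.

Variable tab : seq {set V}.
Hypotheses (n_gt0 : 0 < n) (tab_uniq : uniq tab).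

(** [Q] is the numeric prefix already executed and [ops] are the operations to come. The table
    splits accordingly, so the next merged part sits at position [nnext n Q]. *)
Definition linked s Q (ops : seq (cop V)) :=
  [/\ valid n Q,
      exists2 tab0, tab = tab0 ++ pmap (@merged n) ops & size tab0 = nnext n Q,
      disjoint_parts (cparts s) &
      forall A, A \in cparts s <-> exists2 x, alive n Q x & nth set0 tab x = A].

Lemma linked_index s Q ops x : linked s Q ops -> alive n Q x ->
  index (nth set0 tab x) tab = x.
Proof.
case=> _ [tab0 E s0] _ _ /alive_lt xl; apply: index_uniq => //.
by rewrite E size_cat s0 ltn_addr.
Qed.

Lemma linked_part s Q ops A : linked s Q ops -> A \in cparts s ->
  alive n Q (index A tab) /\ nth set0 tab (index A tab) = A.
Proof. by move=> L; case: (L) => _ _ _ h /h[x Ax <-]; rewrite (linked_index L). Qed.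

Lemma linked_step s o s1 Q ops : linked s Q (o :: ops) -> cstep s o s1 ->
  okop n Q (nenc tab o) /\ linked s1 (rcons Q (nenc tab o)) ops.
Proof.
move=> L st; have [VQ [tab0 E s0] D H] := L.
have D1 := cstep_disjoint st D.
have ok : okop n Q (nenc tab o).
  case: st => A B PA PB; rewrite /okop /=; have [-> eA] := linked_part L PA;
    have [-> eB] := linked_part L PB => //=.
  by apply: contra => /eqP E'; rewrite -eA -eB E'.
split=> //; split=> //; first by apply/valid_rcons.
  rewrite nnext_rcons; case: st E {D1 ok L} => /= A B _ _ => [_||] E.
  - by exists (rcons tab0 (A :|: B)); rewrite ?cat_rcons // size_rcons s0 addn1.
  - by exists tab0; rewrite // s0 addn0.
  - by exists tab0; rewrite // s0 addn0.
move=> C.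
have AR x := alive_rcons n_gt0 x VQ ok.
case: st E ok AR {D1} => /= A B PA PB => [AB||] E ok AR; first last.
- by rewrite H; split=> -[x]; rewrite ?AR => h1 h2; exists x; rewrite ?AR.
- by rewrite H; split=> -[x]; rewrite ?AR => h1 h2; exists x; rewrite ?AR.
have [aA eA] := linked_part L PA; have [aB eB] := linked_part L PB.
have nthx : nth set0 tab (nnext n Q) = A :|: B.
  by rewrite E nth_cat s0 ltnn subnn.
rewrite !inE; split.
  case/orP=> [/eqP->|/and3P[CB CA /(linked_part L)[aC eC]]].
    by exists (nnext n Q); rewrite // AR eqxx.
  exists (index C tab) => //; rewrite AR aC !andbT; apply/orP; right; apply/andP; split.
    by apply: contra CA => /eqP h; rewrite -eC h eA.
  by apply: contra CB => /eqP h; rewrite -eC h eB.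
case=> x; rewrite AR => /orP[/eqP->|/and3P[xA xB ax]] <-; first by rewrite nthx eqxx.
have px : nth set0 tab x \in cparts s by apply/H; exists x.
rewrite px andbT; apply/orP; right; apply/andP; split.
  by apply: contra xB => /eqP <-; rewrite (linked_index L).
by apply: contra xA => /eqP <-; rewrite (linked_index L).
Qed.

Lemma linked_valid s ops s' Q : cpath s ops s' -> linked s Q ops ->
  valid n (Q ++ map (nenc tab) ops).
Proof.
move=> p; elim: p Q => {s ops s'} [s|s o ops s1 s2 st _ IH] Q L; first by rewrite cats0; case: L.
have [ok L1] := linked_step L st.
by rewrite /= -cat_rcons; apply: IH.
Qed.

(** A resolve skips the pairs already decided with the opposite sign, so an undecided pair takes the
    sign of its first resolve. *)
Lemma linked_stat s ops s' Q (a b : V) x y : cpath s ops s' -> linked s Q ops -> a != b ->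
  alive n Q x -> alive n Q y -> a \in nth set0 tab x -> b \in nth set0 tab y ->
  ([set a; b] \in cE s') = ([set a; b] \in cE s) ||
    ([set a; b] \notin cN s) && (stat (map (nenc tab) ops) (nnext n Q) x y == 1).
Proof.
move=> p L ab; elim: p Q x y L => {s ops s'} [s|s o ops s1 s2 st _ IH] Q x y L ax ay ha hb.
  by rewrite andbF orbF.
have [ok L1] := linked_step L st.
have [VQ [tab0 E s0] D H] := L.
have AR z := alive_rcons n_gt0 z VQ ok.
(* As parts are disjoint, membership of a vertex in a part becomes equality of node numbers; this
   turns [pairs_between] into [pmatch]. *)
have cov A z (c : V) : A \in cparts s -> alive n Q z -> c \in nth set0 tab z ->
    (c \in A) = (z == index A tab).
  move=> PA az hc; have [aA eA] := linked_part L PA.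
  have pz : nth set0 tab z \in cparts s by apply/H; exists z.
  apply/idP/eqP => [cA|zE]; last by move: hc; rewrite zE eA.
  by rewrite -(D _ _ _ pz PA hc cA) (linked_index L).
have nx := nnext_rcons n Q (nenc tab o).
case: st E ok AR nx L1 IH => /= A B PA PB => [AB||] E ok AR nx L1 IH; first last.
- rewrite (IH (rcons Q (2, (index A tab, index B tab))) x y) ?AR // nx addn0.
  rewrite !inE in_pairs_between // (cov A x) // (cov B y) // (cov B x) // (cov A y) //.
  rewrite /pmatch /=; case: ifP => _; last by rewrite andbF orbF.
  by case: (_ \in cE s); rewrite //= orbT andbF.
- rewrite (IH (rcons Q (1, (index A tab, index B tab))) x y) ?AR // nx addn0.
  rewrite !inE in_pairs_between // (cov A x) // (cov B y) // (cov B x) // (cov A y) //.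
  rewrite /pmatch /=; case: ifP => _; last by rewrite andbF orbF.
  by case: (_ \in cE s) => //=; case: (_ \in cN s).
have [aA eA] := linked_part L PA; have [aB eB] := linked_part L PB.
have nthx : nth set0 tab (nnext n Q) = A :|: B.
  by rewrite E nth_cat s0 ltnn subnn.
set mo := (0, (index A tab, index B tab)) in AR nx L1 *.
rewrite (IH _ (ropn mo (nnext n Q) x) (ropn mo (nnext n Q) y) L1) ?nx ?addn1 //.
all: rewrite ?AR /ropn /=; case: ifP => [|/norP[z1 z2]] //; rewrite ?eqxx ?z1 ?z2 ?ax ?ay ?orbT //.
  by case/orP=> /eqP h; rewrite nthx inE; move: ha; rewrite h ?eA ?eB => ->; rewrite ?orbT.
by case/orP=> /eqP h; rewrite nthx inE; move: hb; rewrite h ?eA ?eB => ->; rewrite ?orbT.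
Qed.

End Link.

Section Encoding.
Variables (n : nat) (ss : seq (cstate 'I_n)) (ops : seq (cop 'I_n)).
Hypotheses (n_gt0 : 0 < n) (CS : construction_sequence ss ops).

Definition nops := map (nenc (part_table ops)) ops.

Lemma disjoint_singletons : disjoint_parts [set [set v] | v : 'I_n].
Proof.
by move=> A B x /imsetP[a _ ->] /imsetP[b _ ->]; rewrite !inE => /eqP-> /eqP->.
Qed.

Lemma part_table_uniq : uniq (part_table ops).
Proof.
apply: (merged_uniq (construction_cpath CS)) => /=.
- exact: disjoint_singletons.
- apply/imsetP => -[v _ /setP/(_ v)]; by rewrite !inE eqxx.
- by move=> A /imsetP[v _ ->]; apply: map_f; rewrite mem_enum.
- move=> A /mapP[v _ ->]; split; last by exists [set v] => //; apply: imset_f.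
  by apply/set0Pn; exists v; rewrite inE.
by rewrite map_inj_uniq ?enum_uniq //; apply: set1_inj.
Qed.

Lemma part_table_singleton x (xn : x < n) : nth set0 (part_table ops) x = [set Ordinal xn].
Proof.
rewrite nth_cat size_map size_enum_ord xn (nth_map (Ordinal xn)) ?size_enum_ord //.
by congr [set _]; apply: val_inj; rewrite /= nth_enum_ord.
Qed.

Lemma linked_init : linked (part_table ops) cinit [::] ops.
Proof.
split.
- exact: valid_nil.
- by exists [seq [set v] | v <- enum 'I_n] => //; rewrite size_map size_enum_ord.
- exact: disjoint_singletons.
move=> A; split=> [/imsetP[v _ ->]|[x]].
  exists v; first by rewrite alive0.
  by rewrite part_table_singleton; congr [set _]; apply: val_inj.
by rewrite alive0 => xn <-; rewrite part_table_singleton; apply: imset_f.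
Qed.

Lemma nops_valid : valid n nops.
Proof. exact: (linked_valid n_gt0 part_table_uniq (construction_cpath CS) linked_init). Qed.

Lemma nops_stat (G : sgraph 'I_n) (a b : 'I_n) : constructs ss G -> a != b ->
  G a b = (stat nops n a b == 1).
Proof.
move=> -> ab; rewrite (linked_stat n_gt0 part_table_uniq (construction_cpath CS) linked_init ab
  (x := a) (y := b)) ?alive0 //.
- by rewrite !inE.
- by rewrite part_table_singleton inE; apply/eqP/val_inj.
- by rewrite part_table_singleton inE; apply/eqP/val_inj.
Qed.

End Encoding.

(** * Program logic *)

(* The registers are tracked as a list, so that reading and writing a fixed
   register is a computation. *)
Definition assertion := seq nat -> (nat -> nat) -> seq nat -> Prop.

Definition holds (R : assertion) s := exists2 L, regs s =1 nth 0 L & R L (mem s) (out s).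

Definition runs W c t (P R : assertion) := forall s, holds P s ->
  exists t' s', [/\ exec W c s t' s', t' <= t & holds R s'].

Fixpoint evl (L : seq nat) (M : nat -> nat) (e : expr) : nat :=
  match e with
  | Cst k => k
  | Reg r => nth 0 L r
  | Mem a => M (evl L M a)
  | Add e1 e2 => evl L M e1 + evl L M e2
  | Sub e1 e2 => evl L M e1 - evl L M e2
  end.

Definition tevl L M (b : test) : bool :=
  match b with
  | Lt e1 e2 => evl L M e1 < evl L M e2
  | Eq e1 e2 => evl L M e1 == evl L M e2
  end.

(** Loops get the precondition [False], and the dummy cost 0 in [mcost]; [runs_while] treats them
    separately, with loop-free bodies. *)
Fixpoint wp W (c : cmd) (R : assertion) : assertion := fun L M o =>
  match c with
  | Skip => R L M o
  | Assign x e => evl L M e < W /\ R (set_nth 0 L x (evl L M e)) M o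
  | Store a e => [/\ evl L M a < W, evl L M e < W & R L (upd M (evl L M a) (evl L M e)) o]
  | Out e => evl L M e < W /\ R L M (rcons o (evl L M e))
  | Seq c1 c2 => wp W c1 (wp W c2 R) L M o
  | If b c1 c2 => if tevl L M b then wp W c1 R L M o else wp W c2 R L M o
  | While _ _ => False
  end.

Fixpoint mcost (c : cmd) : nat :=
  match c with
  | Skip => 1
  | Assign _ e | Out e => (ecost e).+1
  | Store a e => (ecost a + ecost e).+1
  | Seq c1 c2 => mcost c1 + mcost c2
  | If b c1 c2 => (tcost b + maxn (mcost c1) (mcost c2)).+1
  | While _ _ => 0
  end.

Lemma eval_evl s L e : regs s =1 nth 0 L -> eval s e = evl L (mem s) e.
Proof. by move=> E; elim: e => //= [a ->|e1 -> e2 ->|e1 -> e2 ->]. Qed.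

Lemma teval_tevl s L b : regs s =1 nth 0 L -> teval s b = tevl L (mem s) b.
Proof. by move=> E; case: b => e1 e2 /=; rewrite !(eval_evl _ E). Qed.

Lemma runs_wp W c R : runs W c (mcost c) (wp W c R) R.
Proof.
elim: c R => [|x e|a e|e|c1 IH1 c2 IH2|b c1 IH1 c2 IH2|b c IH] R s [L EL] /= H.
- by exists 1, s; split=> //; [constructor | exists L].
- case: H => eW H; rewrite -(eval_evl e EL) in eW H.
  exists (ecost e).+1; eexists; split; [exact: XAssign | by [] |].
  exists (set_nth 0 L x (eval s e)) => // y; rewrite /= nth_set_nth /= /upd EL.
  by [].
- case: H => aW eW H; rewrite -(eval_evl e EL) -(eval_evl a EL) in aW eW H.
  exists (ecost a + ecost e).+1; eexists; split; [exact: XStore | by [] |].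
  by exists L.
- case: H => eW H; rewrite -(eval_evl e EL) in eW H.
  by exists (ecost e).+1; eexists; split; [exact: XOut | by [] | exists L].
- have [|t1 [s1 [e1 l1 H1]]] := IH1 (wp W c2 R) s; first by exists L.
  have [t2 [s2 [e2 l2 H2]]] := IH2 R s1 H1.
  by exists (t1 + t2), s2; split=> //; [exact: XSeq e1 e2 | lia].
- rewrite -(teval_tevl b EL) in H; case E : (teval s b) H => H.
    have [|t1 [s1 [e1 l1 H1]]] := IH1 R s; first by exists L.
    exists (tcost b + t1).+1, s1; split=> //; first exact: XIfT.
    by rewrite ltnS leq_add2l (leq_trans l1) ?leq_maxl.
  have [|t1 [s1 [e1 l1 H1]]] := IH2 R s; first by exists L.
  exists (tcost b + t1).+1, s1; split=> //; first by apply: XIfF; rewrite ?E.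
  by rewrite ltnS leq_add2l (leq_trans l1) ?leq_maxr.
- by [].
Qed.

Lemma runs_pre W c t (P P' R : assertion) : (forall L M o, P L M o -> P' L M o) ->
  runs W c t P' R -> runs W c t P R.
Proof. by move=> PP r s [L EL H]; apply: r; exists L => //; apply: PP. Qed.

Lemma runs_seq W c1 c2 t1 t2 P P' R : runs W c1 t1 P P' -> runs W c2 t2 P' R ->
  runs W (Seq c1 c2) (t1 + t2) P R.
Proof.
move=> r1 r2 s /r1[t [s1 [e1 l1 /r2[t' [s2 [e2 l2 H]]]]]].
by exists (t + t'), s2; split=> //; [exact: XSeq e1 e2 | lia].
Qed.

(** The index of the invariant is a variant: it drops in every round, so there are at most [k0]
    rounds and one final test. *)
Lemma runs_while W b c (I : nat -> assertion) (k0 : nat) (P R : assertion) :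
  (forall L M o, P L M o -> exists2 k, k <= k0 & I k L M o) ->
  (forall k L M o, I k L M o -> tevl L M b ->
     wp W c (fun L' M' o' => exists2 k', k' < k & I k' L' M' o') L M o) ->
  (forall k L M o, I k L M o -> ~~ tevl L M b -> R L M o) ->
  runs W (While b c) (k0.+1 * (tcost b + mcost c).+1) P R.
Proof.
move=> HP Hs He s [L EL /HP[k kk HI]].
suff: exists t s', [/\ exec W (While b c) s t s', t <= k.+1 * (tcost b + mcost c).+1 & holds R s'].
  case=> t [s' [e l h]]; exists t, s'; split=> //; apply: leq_trans l _.
  by rewrite leq_mul2r ltnS kk orbT.
elim/ltn_ind: k s L EL {HP kk} HI => k IH s L EL HI.
case T : (tevl L (mem s) b); last first.
  exists (tcost b).+1, s; split.
  - by apply: XWhileF; rewrite (teval_tevl b EL) T.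
  - by rewrite mulSn; lia.
  - by exists L => //; apply: He HI _; rewrite T.
have HW : holds (wp W c (fun L' M' o' => exists2 k', k' < k & I k' L' M' o')) s.
  by exists L => //; exact: Hs HI T.
have [t1 [s1 [e1 l1 [L1 EL1 [k' kk' HI']]]]] := runs_wp HW.
have [t2 [s2 [e2 l2 H2]]] := IH k' kk' s1 L1 EL1 HI'.
exists (tcost b + t1 + t2).+1, s2; split=> //.
  by apply: XWhileT e1 e2; rewrite (teval_tevl b EL).
rewrite mulSn; set C := (tcost b + mcost c).+1 in l2 *.
have : k'.+1 * C <= k * C by rewrite leq_mul2r kk' orbT.
have : C = (tcost b + mcost c).+1 by [].
move: (k'.+1 * C) (k * C) l2 => x y; lia.
Qed.

(** * Addresses and memory layout *)

Definition mul3 e := Add e (Add e e).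
Definition opc c i := Add (Cst c) (mul3 i).
(** The machine cannot multiply, so the factor 6 of the record size is spelled out by additions. *)
Definition fld k x := Add (Add (Reg 2) (Add (mul3 x) (mul3 x))) (Cst k).

Local Notation mul3n x := (x + (x + x)).
Local Notation opa c i := (c + mul3n i).
Local Notation fla D k x := (D + (mul3n x + mul3n x) + k).

Section Layout.

(* Operation [i] occupies the three cells from [2 + 3 i] on; cell [D + 6 x + k]
   holds field [k] of record [x]. *)
Definition lay D q (t a b : nat -> nat) (f : nat -> nat -> nat) (M : nat -> nat) :=
  [/\ opa 2 q <= D,
      forall i, i < q -> [/\ M (opa 2 i) = t i, M (opa 3 i) = a i & M (opa 4 i) = b i] &
      forall k x, k < 6 -> M (fla D k x) = f k x].

Definition updf (f : nat -> nat -> nat) k x v k' x' :=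
  if (k' == k) && (x' == x) then v else f k' x'.

Variables (D q : nat) (t a b : nat -> nat) (f : nat -> nat -> nat) (M : nat -> nat).
Hypothesis H : lay D q t a b f M.

Lemma lay_fld k x : k < 6 -> M (fla D k x) = f k x.
Proof. by case: H => _ _ h k6; apply: h. Qed.

Lemma lay_op i : i < q -> [/\ M (opa 2 i) = t i, M (opa 3 i) = a i & M (opa 4 i) = b i].
Proof. by case: H => _ h _ iq; apply: h. Qed.

Lemma lay_set k x v : k < 6 -> lay D q t a b (updf f k x v) (upd M (fla D k x) v).
Proof.
case: H => h1 h2 h3 k6; split=> // [i iq|k' x' k6'].
  by have [? ? ?] := h2 i iq; rewrite /upd !ifF //; lia.
rewrite /upd /updf -h3 //; case: eqP => E; last by rewrite ifF //; lia.
by rewrite ifT //; lia.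
Qed.

Lemma lay_set_t i v : i < q -> lay D q (upd t i v) a b f (upd M (opa 2 i) v).
Proof.
case: H => h1 h2 h3 iq; split=> // [j jq|k x k6].
  have [e1 e2 e3] := h2 j jq; rewrite /upd e1 e2 e3; split; last by rewrite ifF //; lia.
    by have -> : (opa 2 j == opa 2 i) = (j == i) by lia.
  by rewrite ifF //; lia.
by rewrite /upd ifF ?h3 //; lia.
Qed.

Lemma lay_push v0 v1 v2 : opa 2 q.+1 <= D ->
  lay D q.+1 (upd t q v0) (upd a q v1) (upd b q v2) f
    (upd (upd (upd M (opa 2 q) v0) (opa 3 q) v1) (opa 4 q) v2).
Proof.
case: H => h1 h2 h3 qD; split=> // [i iq|k x k6]; last first.
  by rewrite /upd !ifF ?h3 //; lia.
have [->|ne] := eqVneq i q.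
  by rewrite /upd !eqxx; split=> //; rewrite ?ifF ?eqxx //; try lia; rewrite ifF //; lia.
have [|e1 e2 e3] := h2 i; first lia.
by rewrite /upd (negbTE ne); split; rewrite !ifF //; lia.
Qed.

Lemma lay_ext t' a' b' f' : (forall i, i < q -> t i = t' i) -> (forall i, i < q -> a i = a' i) ->
  (forall i, i < q -> b i = b' i) -> (forall k x, k < 6 -> f k x = f' k x) ->
  lay D q t' a' b' f' M.
Proof.
case: H => h1 h2 h3 et ea eb ef; split=> // [i iq|k x k6]; last by rewrite -ef // h3.
by rewrite -et // -ea // -eb //; apply: h2.
Qed.

End Layout.

(** * Building the tree *)

Local Notation "c1 ;; c2" := (Seq c1 c2) (at level 90, right associativity).

(* Registers: 0 vertices, 1 operations, 2 base of the records, 3 loop index,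
   4 next node, 5-6 arguments, 7 pending node or list pointer, 8 nodes, 9 pairs,
   10 operation type.  Fields: 0 parent, 1 type of the next resolve inside the
   part, 2 bucket head, 3 stamp, 4 bucket successor, 5 kept. *)
Definition incr r := Assign r (Add (Reg r) (Cst 1)).

Definition load_op :=
  Assign 10 (Mem (opc 2 (Reg 3))) ;;
  Assign 5 (Mem (opc 3 (Reg 3))) ;;
  Assign 6 (Mem (opc 4 (Reg 3))).

Definition set_parents :=
  Store (fld 0 (Reg 5)) (Reg 4) ;; Store (fld 0 (Reg 6)) (Reg 4) ;; incr 4.

(** The records start behind room for [n] extra operations, enough for the completing merges. *)
Definition prog_init :=
  Assign 0 (Mem (Cst 0)) ;;
  Assign 1 (Mem (Cst 1)) ;;
  Assign 2 (opc 2 (Add (Reg 1) (Reg 0))) ;;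
  Assign 4 (Reg 0) ;;
  Assign 8 (Sub (Add (Reg 0) (Reg 0)) (Cst 1)).

Definition replay_body :=
  load_op ;; If (Eq (Reg 10) (Cst 0)) set_parents Skip ;; incr 3.
Definition replay_test := Lt (Reg 3) (Reg 1).

(** Nodes are scanned in order of creation, including those created meanwhile. A parentless node is
    held in register 7, shifted by one so that 0 means none, until the next parentless node is found
    and merged with it. *)
Definition complete_body :=
  If (Eq (Mem (fld 0 (Reg 3))) (Cst 0))
    (If (Eq (Reg 7) (Cst 0))
      (Assign 7 (Add (Reg 3) (Cst 1)))
      (Assign 5 (Sub (Reg 7) (Cst 1)) ;;
       Assign 6 (Reg 3) ;;
       Store (opc 2 (Reg 1)) (Cst 0) ;;
       Store (opc 3 (Reg 1)) (Reg 5) ;;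
       Store (opc 4 (Reg 1)) (Reg 6) ;;
       set_parents ;;
       incr 1 ;;
       Assign 7 (Cst 0)))
    Skip ;;
  incr 3.
Definition complete_test := Lt (Reg 4) (Reg 8).

Local Notation opn Q i := (nth nop0 Q i).
Local Notation opT Q := (fun i => (opn Q i).1).
Local Notation opA Q := (fun i => (opn Q i).2.1).
Local Notation opB Q := (fun i => (opn Q i).2.2).

Section Program.
Variables (n : nat) (Q0 : seq nop) (W : nat).
Hypotheses (n_gt0 : 0 < n) (V0 : valid n Q0) (HW : 40 * (size Q0 + n) <= W).
Notation m := (n.-1).*2.+1.
Notation S := (size Q0).
Notation D := (opa 2 (S + n)).

Definition minput := n :: S :: flatten (map nop_code Q0).

Lemma nth_nop_codes (Q : seq nop) i c : i < size Q -> c < 3 ->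
  nth 0 (flatten (map nop_code Q)) (c + mul3n i) = nth 0 (nop_code (opn Q i)) c.
Proof.
elim: Q i => [//|o Q IH] [|i] /= iQ c3.
  by case: c c3 {IH} => [|[|[|]]].
have -> : c + mul3n i.+1 = (c + mul3n i).+3 by lia.
by rewrite /= IH.
Qed.

Definition post_init : assertion := fun L M o =>
  [/\ L = [:: n; S; D; 0; n; 0; 0; 0; m; 0; 0],
      lay D S (opT Q0) (opA Q0) (opB Q0) (fun _ _ => 0) M & o = [::]].

Lemma runs_init : runs W prog_init (mcost prog_init)
  (fun L M o => [/\ L = nseq 11 0, M = nth 0 minput & o = [::]]) post_init.
Proof.
apply: (runs_pre _ (@runs_wp _ _ _)) => L M o [-> -> ->] /=.
have -> : n + n - 1 = m by lia.
do 5 (split; first lia); split=> //.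
split; first lia.
  by move=> i iS; split;
    [rewrite -[opa 2 i]/((opa 0 i).+2) | rewrite -[opa 3 i]/((opa 1 i).+2)
    | rewrite -[opa 4 i]/((opa 2 i).+2)]; rewrite /= nth_nop_codes.
(* The records lie beyond the input, where memory is zero, the initial value of every field. *)
move=> k x _; apply: nth_default; rewrite /= size_flatten /shape -map_comp.
have -> : sumn [seq (size \o nop_code) i | i <- Q0] = mul3n S.
  by elim: (Q0) => //= o' Q ->; lia.
lia.
Qed.

Definition replay_inv k : assertion := fun L M o =>
  exists i f x5 x6 x10,
  [/\ k + i = S, L = [:: n; S; D; i; nnext n (take i Q0); x5; x6; 0; m; 0; x10],
      lay D S (opT Q0) (opA Q0) (opB Q0) f M,
      (forall x, f 0 x = npar n (take i Q0) x) /\ (forall j x, f j.+1 x = 0) & o = [::]].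

(** At most one node behind the scan position [x] is parentless, namely [hold.-1]. *)
Definition complete_inv k : assertion := fun L M o =>
  exists X x hold f x5 x6 x10, let Q := Q0 ++ X in
  [/\ [/\ valid n Q, all (fun o : nop => o.1 == 0) X, k + x = m & x <= nnext n Q],
      (forall y, y < x -> npar n Q y = 0 -> hold = y.+1) /\
      (0 < hold -> hold <= x /\ npar n Q hold.-1 = 0),
      L = [:: n; size Q; D; x; nnext n Q; x5; x6; hold; m; 0; x10],
      lay D (size Q) (opT Q) (opA Q) (opB Q) f M &
      [/\ forall x, f 0 x = npar n Q x, forall j x, f j.+1 x = 0 & o = [::]]].

Lemma runs_replay : runs W (While replay_test replay_body)
  (S.+1 * (tcost replay_test + mcost replay_body).+1) post_init
  (replay_inv 0).
Proof.
apply: (@runs_while _ _ _ replay_inv).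
- move=> L M o [-> H ->]; exists S => //; exists 0, (fun _ _ => 0), 0, 0, 0.
  by rewrite take0 addn0.
- move=> k L M o [i [f [x5 [x6 [x10 [ki -> H [f0 fS] ->]]]]]] /= iS.
  have [-> -> ->] := lay_op H iS.
  have Vi : valid n (take i Q0) by apply: (@valid_catl _ _ (drop i Q0)); rewrite cat_take_drop.
  have /and4P[t2 A B AB] := V0 iS; have := alive_lt A; have := alive_lt B => lB lA.
  have nl := nnext_lt n_gt0 Vi.
  do 3 (split; first lia).
  have tk := take_nth nop0 iS.
  case: ifP => t0.
    split; try lia; split; try lia; do 2 (split; first lia).
    exists k.-1; first lia.
    exists i.+1; do 4 eexists; split; [| |do 2 (apply: lay_set => //); exact: H| |]; rewrite ?addn1 //; first lia.
      by rewrite tk nnext_rcons t0 addn1.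
    rewrite /updf; split=> // x /=; rewrite tk npar_rcons t0 f0 /=.
    by case: (x == _.2.2); case: (x == _).
  split; first lia.
  exists k.-1; first lia.
  exists i.+1; do 4 eexists; split; [| |exact: H| |]; rewrite ?addn1 //; first lia.
    by rewrite tk nnext_rcons t0 addn0.
  by split=> // x; rewrite tk npar_rcons t0 f0.
- move=> k L M o [i [f [x5 [x6 [x10 [ki -> H [f0 fS] ->]]]]]] /= iS.
  by exists i, f, x5, x6, x10; split=> //; lia.
Qed.

(** If the scan had passed all nodes, only the held one could be alive; but an incomplete tree has
    at least two alive nodes. *)
Lemma alive_pending Q x hold : valid n Q -> nnext n Q < m -> x <= nnext n Q ->
  (forall y, y < x -> npar n Q y = 0 -> hold = y.+1) -> x < nnext n Q.
Proof.
move=> VQ nm xn h; apply/negPn/negP => nx.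
have [L [uL ML sL]] := alive_count n_gt0 VQ.
have sub : {subset L <= [:: hold.-1]}.
  move=> y; rewrite ML inE => /andP[yn /eqP y0]; apply/eqP.
  by rewrite (h y) //; lia.
have := uniq_leq_size uL sub; rewrite /=; lia.
Qed.

Definition post_complete : assertion := fun L M o =>
  exists Q hold f x5 x6 x10,
  [/\ [/\ valid n Q, exists2 X, Q = Q0 ++ X & all (fun o : nop => o.1 == 0) X & nnext n Q = m],
      L = [:: n; size Q; D; size Q; m; x5; x6; hold; m; 0; x10],
      lay D (size Q) (opT Q) (opA Q) (opB Q) f M &
      [/\ forall x, f 0 x = fpar n Q x, forall j x, f j.+1 x = 0 & o = [::]]].

Definition reset_index := Assign 3 (Cst 0).

Definition finish_tree :=
  Store (fld 0 (Sub (Reg 8) (Cst 1))) (Sub (Reg 8) (Cst 1)) ;; Assign 3 (Reg 1).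

Lemma runs_reset : runs W reset_index (mcost reset_index) (replay_inv 0) (complete_inv m).
Proof.
apply: (runs_pre _ (@runs_wp _ _ _)) => L M o [i [f [x5 [x6 [x10 [ki -> H [f0 fS] ->]]]]]] /=.
split; first lia.
exists [::], 0, 0, f, x5, x6, x10; rewrite cats0 addn0.
have -> : Q0 = take i Q0 by rewrite take_oversize //; lia.
have iS : take i Q0 = Q0 by rewrite take_oversize //; lia.
rewrite !iS in f0 *; split=> //.
Qed.

Lemma runs_complete : runs W (While complete_test complete_body)
  (m.+1 * (tcost complete_test + mcost complete_body).+1) (complete_inv m)
  (fun L M o => exists2 k, complete_inv k L M o & ~~ tevl L M complete_test).
Proof.
apply: (@runs_while _ _ _ complete_inv).
- by move=> L M o H; exists m.
- move=> k L M o [X [x [hold [f [x5 [x6 [x10 /=]]]]]]].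
  case=> [[VQ aX kx xn] [h1 h2] -> H [f0 fS ->]] /= nm.
  set Q := Q0 ++ X in VQ xn h1 h2 H f0 nm *.
  have xl := alive_pending VQ nm xn h1.
  have szQ : size Q = S + size X by rewrite size_cat.
  (* Each appended merge creates a node and fewer than [2n - 1] nodes exist, so the appended
     operations fit into the reserved room. *)
  have sX : size X < n.
    have := nnext_count n Q; rewrite count_cat.
    have -> : count (fun o : nop => o.1 == 0) X = size X by apply/eqP; rewrite -all_count.
    by lia.
  have Hx := lay_fld H x (k := 0) isT.
  rewrite Hx f0.
  case: eqP => px; last first.
    split; first lia.
    exists k.-1; first lia.
    exists X, x.+1, hold, f, x5, x6, x10; rewrite -/Q addn1; split=> //; first by split=> //; lia.
    split=> [y yx py|/h2[]]; last by move=> *; split=> //; lia.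
    by apply: h1 (py); have [yE|] := eqVneq y x; [rewrite yE in py | lia].
  case: eqP => h0.
    do 2 (split; first lia).
    exists k.-1; first lia.
    exists X, x.+1, x.+1, f, x5, x6, x10; rewrite -/Q !addn1; split=> //; first by split=> //; lia.
    split=> [y yx py|_]; last by split.
    by have [->//|ne] := eqVneq y x; have := h1 y; lia.
  have [hx hp] : hold <= x /\ npar n Q hold.-1 = 0 by apply: h2; lia.
  have -> : hold - 1 = hold.-1 by lia.
  pose o1 : nop := (0, (hold.-1, x)).
  have ok : okop n Q o1.
    by rewrite /okop /alive /= hp px !eqxx !andbT; apply/and3P; split; lia.
  do 2 (split; first lia).
  do 3 (split; try lia).
  do 2 (split; try lia).
  do 4 (split; first lia).
  exists k.-1; first lia.
  have rc : rcons Q o1 = Q0 ++ rcons X o1 by rewrite -rcons_cat.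
  have Vr : valid n (rcons Q o1) by apply/valid_rcons.
  have nr : nnext n (rcons Q o1) = (nnext n Q).+1 by rewrite nnext_rcons addn1.
  have pr y : npar n (rcons Q o1) y =
      if (y == hold.-1) || (y == x) then nnext n Q else npar n Q y by rewrite npar_rcons.
  have nn := nnext_ge n Q.
  exists (rcons X o1), x.+1, 0.
  exists (updf (updf f 0 hold.-1 (nnext n Q)) 0 x (nnext n Q)), hold.-1, x, x10.
  rewrite -rc; cbv zeta; rewrite nr size_rcons !addn1; split=> //.
  - by split; rewrite ?all_rcons //=; lia.
  - by split=> // y yx; rewrite pr; case: ifP => [_|/norP[y1 y2]]; [|move/h1]; lia.
  - do 2 (apply: lay_set => //).
    apply: (lay_ext (lay_push H 0 hold.-1 x _)); first by rewrite szQ; lia.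
    1-3: by move=> i iQ; rewrite /upd nth_rcons;
      case: eqP => [->|ne]; rewrite ?ltnn ?eqxx // ifT //; lia.
    by [].
  - split=> // y.
    by rewrite /updf /= pr f0; case: (y == x); rewrite ?orbT ?orbF.
- by move=> k L M o H T; exists k.
Qed.

Lemma runs_finish : runs W finish_tree (mcost finish_tree)
  (fun L M o => exists2 k, complete_inv k L M o & ~~ tevl L M complete_test) post_complete.
Proof.
apply: (runs_pre _ (@runs_wp _ _ _)) => L M o [k [X [x [hold [f [x5 [x6 [x10 /=]]]]]]]].
case=> [[VQ aX kx xn] [h1 h2] -> H [f0 fS ->]] /= nm.
set Q := Q0 ++ X in VQ xn h1 h2 H f0 nm *.
have nl := nnext_lt n_gt0 VQ.
have nE : nnext n Q = m by lia.
have szQ : size Q = S + size X by rewrite size_cat.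
have sX : size X < n.
  have := nnext_count n Q; rewrite count_cat.
  have -> : count (fun o : nop => o.1 == 0) X = size X by apply/eqP; rewrite -all_count.
  by lia.
split; try lia; split; first lia.
exists Q, hold, (updf f 0 (m - 1) (m - 1)), x5, x6, x10; split.
- by split=> //; exists X.
- by rewrite nE.
- exact: lay_set.
split=> // y.
by rewrite /updf /fpar f0 /= subn1.
Qed.

End Program.

(** * Signs and buckets *)

(* The cutoff subtraction gives [min(a, b) = a - (a - b)] and
   [max(a, b) = b + (a - b)]. *)
Definition bucket_op :=
  If (Eq (Reg 5) (Reg 6))
    (Store (fld 1 (Reg 5)) (Reg 10))
    (Assign 7 (Sub (Reg 5) (Sub (Reg 5) (Reg 6))) ;;
     Store (fld 4 (Reg 3)) (Mem (fld 2 (Reg 7))) ;;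
     Store (fld 2 (Reg 7)) (Add (Reg 3) (Cst 1))).

(** In the backward pass, decrementing register 4 at each merge recovers the node it created. The
    pending self-resolve type of that node passes to both children and replaces the type of the
    merge. *)
Definition sign_body :=
  Assign 3 (Sub (Reg 3) (Cst 1)) ;;
  load_op ;;
  If (Eq (Reg 10) (Cst 0))
    (Assign 4 (Sub (Reg 4) (Cst 1)) ;;
     Assign 10 (Mem (fld 1 (Reg 4))) ;;
     Store (fld 1 (Reg 5)) (Reg 10) ;;
     Store (fld 1 (Reg 6)) (Reg 10) ;;
     Store (opc 2 (Reg 3)) (Reg 10))
    Skip ;;
  bucket_op.
Definition sign_test := Lt (Cst 0) (Reg 3).

Lemma stat_le Q y0 x y c : all (fun o : nop => o.1 <= c) Q -> stat Q y0 x y <= c.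
Proof.
elim: Q y0 x y => [//|o Q IH] y0 x y /= /andP[oc /IH h].
by case: ifP => // _; case: ifP.
Qed.

Section Signs.
Variables (n : nat) (Q : seq nop) (D W : nat).
Hypotheses (n_gt0 : 0 < n) (V : valid n Q).
Notation m := (n.-1).*2.+1.
Hypotheses (Qm : nnext n Q = m) (HW : D + 6 * (size Q + m) + 20 <= W).
Notation q := (size Q).
Notation nx i := (nnext n (take i Q)).
Notation key e := ((opn Q e).2.1 - ((opn Q e).2.1 - (opn Q e).2.2)).
Notation val e := ((opn Q e).2.2 + ((opn Q e).2.1 - (opn Q e).2.2)).

(** Here [p] is a list pointer into bucket [y]: 0 is the end of the list and [e.+1] points to
    operation [e]. Buckets list operations in increasing order. *)
Definition first_from y k (p : nat) :=
  if p is e.+1 then [/\ k <= e < q, sel Q e, key e = y &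
    forall e', k <= e' < e -> sel Q e' -> key e' <> y]
  else forall e', k <= e' < q -> sel Q e' -> key e' <> y.

Lemma first_fromS y k p : first_from y k.+1 p -> (sel Q k -> key k <> y) -> first_from y k p.
Proof.
case: p => [|e] /= h hk.
  move=> e' ke se; have [E|ne] := eqVneq e' k; last by apply: h => //; lia.
  by rewrite E in se *; apply: hk.
case: h => ? ? ? h; split=> //; first lia.
move=> e' ke se; have [E|ne] := eqVneq e' k; last by apply: h => //; lia.
by rewrite E in se *; apply: hk.
Qed.

Lemma first_from_le y k p : first_from y k p -> p <= q.
Proof. by case: p => // e [] /andP[]. Qed.

Lemma Q_type e : e < q -> (opn Q e).1 <= 2.
Proof. by move=> /V/and4P[]. Qed.

Lemma stat_le2 k y0 x y : stat (drop k Q) y0 x y <= 2.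
Proof.
apply: stat_le; apply/(all_nthP nop0) => i; rewrite size_drop nth_drop => iq.
by apply: Q_type; lia.
Qed.

Lemma sgn_le2 e : e < q -> sgn n Q e <= 2.
Proof. by move=> eq; rewrite /sgn; case: ifP => _; [exact: stat_le2 | exact: Q_type]. Qed.

Lemma ops_lt e : e < q -> (opn Q e).2.1 < nx e /\ (opn Q e).2.2 < nx e.
Proof. by move=> /V/and4P[_ /alive_lt A /alive_lt B _]. Qed.

Definition sign_inv k : assertion := fun L M o =>
  exists f x5 x6 x7 x10,
  [/\ k <= q, L = [:: n; q; D; k; nx k; x5; x6; x7; m; 0; x10],
      lay D q (fun i => if i < k then (opn Q i).1 else sgn n Q i) (opA Q) (opB Q) f M,
      [/\ forall x, f 0 x = fpar n Q x,
          forall x, f 1 x = stat (drop k Q) (nx k) x x,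
          forall y, first_from y k (f 2 y),
          forall e, k <= e < q -> sel Q e -> first_from (key e) e.+1 (f 4 e) &
          forall x, f 3 x = 0 /\ f 5 x = 0] &
      o = [::]].

(** A merge has distinct arguments, so only a self-resolve of [x] can match; otherwise [x] just
    moves to its new part. *)
Lemma stat_drop j x : j < q -> stat (drop j Q) (nx j) x x =
  if (x == (opn Q j).2.1) && (x == (opn Q j).2.2) then sgn n Q j
  else stat (drop j.+1 Q) (nx j.+1) (ropn (opn Q j) (nx j) x) (ropn (opn Q j) (nx j) x).
Proof.
move=> jq; rewrite (drop_nth nop0 jq) /= nnext_takeS // /sgn /pmatch /ropn.
have /and4P[_ _ _ AB] := V jq.
case: eqP AB => t0 /= AB; last by rewrite addn0 [X in _ || X]andbC orbb.
have -> : (x == (opn Q j).2.1) && (x == (opn Q j).2.2) = false by lia.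
by rewrite addn1.
Qed.

(** The common tail of both branches: field 1 has already been passed through a possible merge, so
    only a self-resolve remains to be recorded. *)
Lemma wp_bucket j L M f x7 : j < q ->
  L = [:: n; q; D; j; nx j; (opn Q j).2.1; (opn Q j).2.2; x7; m; 0; sgn n Q j] ->
  lay D q (fun i => if i < j then (opn Q i).1 else sgn n Q i) (opA Q) (opB Q) f M ->
  (forall x, f 0 x = fpar n Q x) ->
  (forall x, f 1 x = stat (drop j.+1 Q) (nx j.+1) (ropn (opn Q j) (nx j) x)
                       (ropn (opn Q j) (nx j) x)) ->
  (forall y, first_from y j.+1 (f 2 y)) ->
  (forall e, j < e < q -> sel Q e -> first_from (key e) e.+1 (f 4 e)) ->
  (forall x, f 3 x = 0 /\ f 5 x = 0) ->
  wp W bucket_op (sign_inv j) L M [::].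
Proof.
move=> jq -> H f0 f1 f2 f4 f35; rewrite /bucket_op /=.
have [lA lB] := ops_lt jq; have nm := nnext_take_le Qm j; have s2 := sgn_le2 jq.
case: ifP => AB.
  split; try lia.
  do 5 eexists; split; [lia | reflexivity | apply: lay_set => //; exact: H | | by []].
  rewrite /updf /=; split=> //.
  - by move=> x; rewrite stat_drop // -(eqP AB) andbb f1.
  - by move=> y; apply: first_fromS (f2 y) _; rewrite /sel AB.
  - move=> e je se; apply: f4 => //.
    by have [E|ne] := eqVneq e j; [move: se; rewrite /sel E AB | lia].
rewrite (lay_fld H) //; set y := key j.
have ly := first_from_le (f2 y).
split; first lia; split; try lia; split; try lia.
do 5 eexists; split; [lia | reflexivity | do 2 (apply: lay_set => //); exact: H | | by []].
rewrite /updf /= addn1; split=> //.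
- move=> x; rewrite stat_drop // ifF //; apply: contraFF AB => /andP[/eqP<- //].
- move=> z; case: eqP => [->|ne] /=; first by rewrite /sel AB; split=> //; lia.
  by apply: first_fromS (f2 z) _ => _ E; apply: ne.
- move=> e je se; case: eqP => [->|ne]; first exact: f2.
  by apply: f4 => //; lia.
Qed.

Definition pre_sign : assertion := fun L M o =>
  exists hold f x5 x6 x10,
  [/\ L = [:: n; q; D; q; m; x5; x6; hold; m; 0; x10],
      lay D q (opT Q) (opA Q) (opB Q) f M &
      [/\ forall x, f 0 x = fpar n Q x, forall j x, f j.+1 x = 0 & o = [::]]].

Lemma runs_sign N : q <= N -> runs W (While sign_test sign_body)
  (N.+1 * (tcost sign_test + mcost sign_body).+1) pre_sign (sign_inv 0).
Proof.
move=> qN; apply: (@runs_while _ _ _ sign_inv).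
- move=> L M o [hold [f [x5 [x6 [x10 [-> H [f0 fS ->]]]]]]].
  exists q => //; exists f, x5, x6, hold, x10; rewrite take_size Qm; split=> //.
    by apply: (lay_ext H) => // i ->.
  split=> //; first by move=> x; rewrite fS drop_size.
    by move=> y; rewrite fS /=; lia.
  lia.
- move=> [|j] L M o [f [x5 [x6 [x7 [x10 [kq -> H [f0 f1 f2 f4 f35] ->]]]]]] //= _.
  rewrite subn1 /=.
  have [-> -> ->] := lay_op H kq; rewrite leqnn.
  have [lA lB] := ops_lt kq; have t2 := Q_type kq; have nm := nnext_take_le Qm j.
  have dn := drop_nth nop0 kq; have nxS := nnext_takeS n kq.
  have /and4P[_ _ _ AB] := V kq.
  split; first lia.
  do 3 (split; first lia).
  (* Weakening the postcondition to the form that the loop rule demands. *)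
  have incl L' M' : wp W bucket_op (sign_inv j) L' M' [::] ->
      wp W bucket_op (fun L1 M1 o1 => exists2 k', k' < j.+1 & sign_inv k' L1 M1 o1) L' M' [::].
    by rewrite /bucket_op /=; case: ifP => _ => [[? ? ?]|[? [? ? [? ? ?]]]]; do ?split=> //; exists j.
  case: ifP => t0; rewrite t0 /= in AB nxS; last first.
    apply: (incl [:: n; q; D; j; nx j.+1; (opn Q j).2.1; (opn Q j).2.2; x7; m; 0; (opn Q j).1] M).
    apply: (wp_bucket (f := f)) => //.
    - by rewrite nxS addn0 /sgn t0.
    - apply: (lay_ext H) => // i iq.
      have [->|ne] := eqVneq i j; first by rewrite ltnn leqnn /sgn t0.
      by have -> : (i < j.+1) = (i < j) by lia.
    - by move=> x; rewrite f1 /ropn t0.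
  have -> : nx j.+1 - 1 = nx j by lia.
  rewrite (lay_fld H) // f1.
  have sg : sgn n Q j = stat (drop j.+1 Q) (nx j.+1) (nx j) (nx j).
    by rewrite /sgn t0 nxS addn1.
  have l2 := sgn_le2 kq.
  rewrite -sg; set s := sgn n Q j in sg l2 *.
  do 2 (split; first lia); split; try lia; split; try lia; split; try lia.
  apply: (incl [:: n; q; D; j; nx j; (opn Q j).2.1; (opn Q j).2.2; x7; m; 0; s]
    (upd (upd (upd M (fla D 1 (opn Q j).2.1) s) (fla D 1 (opn Q j).2.2) s) (opa 2 j) s)).
  apply: (wp_bucket (f := updf (updf f 1 (opn Q j).2.1 s) 1 (opn Q j).2.2 s)) => //.
  - apply: (lay_ext (lay_set_t (lay_set (k := 1) (lay_set (k := 1) H _ _ _) _ _ _) _ _)) => // i iq.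
    rewrite /upd; case: eqP => [->|ne]; first by rewrite ltnn.
    by have -> : (i < j.+1) = (i < j) by lia.
  - move=> x; rewrite /updf /ropn t0 /= f1.
    by case: (x == _.2.2); case: (x == _); rewrite //= sg.
- move=> k L M o [f [x5 [x6 [x7 [x10 [kq -> H F ->]]]]]] /=; rewrite -leqNgt leqn0 => /eqP k0.
  by subst k; exists f, x5, x6, x7, x10.
Qed.

End Signs.

(** * Removing duplicates and printing *)

Definition dedup_init := Assign 7 (Mem (fld 2 (Reg 3))).

(** Bucket [u] uses the stamp [u.+1], which differs from bucket to bucket and from the initial 0, so
    stamps are never cleared. *)
Definition dedup_body :=
  If (Eq (Reg 7) (Cst 0))
    (incr 3 ;; Assign 7 (Mem (fld 2 (Reg 3))))
    (Assign 10 (Sub (Reg 7) (Cst 1)) ;;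
     Assign 5 (Mem (opc 3 (Reg 10))) ;;
     Assign 6 (Mem (opc 4 (Reg 10))) ;;
     Assign 5 (Add (Reg 6) (Sub (Reg 5) (Reg 6))) ;;
     If (Eq (Mem (fld 3 (Reg 5))) (Add (Reg 3) (Cst 1)))
       Skip
       (Store (fld 3 (Reg 5)) (Add (Reg 3) (Cst 1)) ;;
        Store (fld 5 (Reg 10)) (Cst 1) ;;
        incr 9) ;;
     Assign 7 (Mem (fld 4 (Reg 10)))).
Definition dedup_test := Lt (Reg 3) (Reg 8).

Definition out_init := Out (Reg 8) ;; Assign 3 (Cst 0).
Definition out_parent_body := Out (Mem (fld 0 (Reg 3))) ;; incr 3.
Definition out_parent_test := Lt (Reg 3) (Reg 8).
Definition out_leaf_body := Out (Reg 3) ;; incr 3.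
Definition out_leaf_test := Lt (Reg 3) (Reg 0).
Definition out_mid := Out (Reg 9) ;; Assign 3 (Cst 0).

(* The output tag is 1 for the type 1 and 0 for the types 0 and 2. *)
Definition out_pair_body :=
  If (Eq (Mem (fld 5 (Reg 3))) (Cst 1))
    (load_op ;;
     Out (Sub (Reg 10) (Add (Sub (Reg 10) (Cst 1)) (Sub (Reg 10) (Cst 1)))) ;;
     Out (Reg 5) ;;
     Out (Reg 6))
    Skip ;;
  incr 3.
Definition out_pair_test := Lt (Reg 3) (Reg 1).

Lemma iota0S i : iota 0 i.+1 = rcons (iota 0 i) i.
Proof. by rewrite -addn1 iotaD cats1. Qed.

Section Output.
Variables (n : nat) (Q : seq nop) (D W : nat).
Hypotheses (n_gt0 : 0 < n) (V : valid n Q).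
Notation m := (n.-1).*2.+1.
Hypotheses (Qm : nnext n Q = m) (HW : D + 6 * (size Q + m) + 20 <= W).
Notation q := (size Q).
Notation nx i := (nnext n (take i Q)).
Notation key e := ((opn Q e).2.1 - ((opn Q e).2.1 - (opn Q e).2.2)).
Notation val e := ((opn Q e).2.2 + ((opn Q e).2.1 - (opn Q e).2.2)).
Notation first_from := (first_from Q).

(** Two unordered pairs agree exactly when their minima and their maxima do; the former select the
    bucket, the latter carry the stamp. *)
Lemma keptE e : kept Q e =
  sel Q e && ~~ has (fun j => (key j == key e) && (val j == val e)) (iota 0 e).
Proof.
rewrite /kept -all_predC; congr (_ && _); apply: eq_all => j /=.
by rewrite /pmatch; lia.
Qed.

Lemma op_lt e : e < q -> (opn Q e).2.1 < m /\ (opn Q e).2.2 < m.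
Proof. by move=> eq; have := ops_lt V eq; have := nnext_take_le Qm e; lia. Qed.

(** Each round opens the next bucket or handles one operation, so [m + q] bounds the rounds; [done]
    lists the handled operations, those of bucket [u] being the ones below [j]. *)
Definition dedup_inv k : assertion := fun L M o =>
  exists u j ptr done f x4 x5 x6 x10,
  [/\ k + u + size done = m + q /\ o = [::],
      L = [:: n; q; D; u; x4; x5; x6; ptr; m; count (kept Q) done; x10],
      lay D q (sgn n Q) (opA Q) (opB Q) f M,
      [/\ forall x, f 0 x = fpar n Q x,
          forall y, first_from y 0 (f 2 y),
          forall e, e < q -> sel Q e -> first_from (key e) e.+1 (f 4 e),
          forall v, (f 3 v == u.+1) = has (fun e => (key e == u) && (val e == v)) done &
          (forall v, f 3 v <= u.+1) /\ forall e, f 5 e = (e \in done) && kept Q e] &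
      [/\ first_from u j ptr, uniq done &
          forall e, (e \in done) =
            [&& e < q, sel Q e & (key e < u) || (key e == u) && (e < j)]]].

Lemma done_size (done : seq nat) (P : pred nat) : uniq done ->
  (forall e, (e \in done) = (e < q) && P e) -> size done <= q.
Proof.
move=> ud H; rewrite -(size_iota 0 q); apply: uniq_leq_size => // e.
by rewrite H mem_iota => /andP[].
Qed.

Lemma runs_dedup_init : runs W dedup_init (mcost dedup_init) (sign_inv n Q D 0)
  (dedup_inv (m + q)).
Proof.
apply: (runs_pre _ (@runs_wp _ _ _)) => L M o.
case=> f [x5 [x6 [x7 [x10 [_ -> H [f0 f1 f2 f4 f35] ->]]]]] /=.
rewrite (lay_fld H) //.
split; first by have := first_from_le (f2 0); lia.
exists 0, 0, (f 2 0), [::], f, (nx 0), x5, x6, x10; split=> //; first by rewrite !addn0.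
  split=> //; first by move=> v; have [-> _] := f35 v.
  by split=> e; have [f3 f5] := f35 e; rewrite ?f3 ?f5.
by split=> // e; rewrite !ltn0 !andbF.
Qed.

Definition out_base (M : nat -> nat) := exists2 f,
  lay D q (sgn n Q) (opA Q) (opB Q) f M &
  (forall x, f 0 x = fpar n Q x) /\ forall e, e < q -> f 5 e = kept Q e.

Notation cnt := (count (kept Q) (iota 0 q)).

Definition post_dedup : assertion := fun L M o =>
  exists x3 x4 x5 x6 x7 x10,
  [/\ L = [:: n; q; D; x3; x4; x5; x6; x7; m; cnt; x10], out_base M & o = [::]].

Lemma runs_dedup N : m + q <= N -> runs W (While dedup_test dedup_body)
  (N.+1 * (tcost dedup_test + mcost dedup_body).+1) (dedup_inv (m + q)) post_dedup.
Proof.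
move=> mN; apply: (@runs_while _ _ _ dedup_inv).
- by move=> L M o H; exists (m + q).
- move=> k L M o [u [j [ptr [done [f [x4 [x5 [x6 [x10]]]]]]]]].
  case=> [[ks ->] -> H [f0 f2 f4 f3 [f3le f5]] [ff ud dE]] /= um.
  have sd := done_size ud dE.
  case: eqP ff => [->|p0] ff.
    split; first lia.
    rewrite (lay_fld H) // addn1; split; first by have := first_from_le (f2 u.+1); lia.
    exists k.-1; first lia.
    exists u.+1, 0, (f 2 u.+1), done, f, x4, x5, x6, x10; split=> //.
    + by split=> //; lia.
    + split=> //; last by split=> // v; have := f3le v; lia.
      (* Stamps so far are at most [u.+1], so nothing is stamped for the new bucket. *)
      move=> v; have /negbTE -> : f 3 v != u.+2 by have := f3le v; lia.
      by apply/esym/hasPn => e; rewrite dE => /and3P[_ _ h]; lia.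
    split=> // e; rewrite dE ltn0 andbF orbF.
    case: ltnP => //= eq; case se : (sel Q e) => //=.
    have := ff e; rewrite eq se andbT; move: (key e) => c h; lia.
  case: ptr p0 ff => [//|e] _ [je se ke nj].
  rewrite subn1 /=; have /andP[je' eq] := je.
  have [_ -> ->] := lay_op H eq; rewrite (lay_fld H) //.
  have [lA lB] := op_lt eq.
  have eD : e \notin done by rewrite dE; lia.
  (* An earlier operation with the same pair is in the same bucket, so it has been handled and has
     left its stamp. *)
  have kE : kept Q e = (f 3 (val e) != u.+1).
    rewrite keptE se f3 /=; congr (~~ _); apply/hasP/hasP => -[e' h1 /andP[/eqP h2 h3]].
      have e'e : e' < e by move: h1; rewrite mem_iota.
      have se' : sel Q e' by move: se; rewrite /sel; lia.
      exists e'; last by rewrite h2 ke eqxx.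
      rewrite dE se' h2 ke ltnn eqxx /=; apply/andP; split; first lia.
      by apply/negPn/negP => je''; apply: (nj e'); rewrite ?h2 //; lia.
    exists e'; last by rewrite h2 ke eqxx.
    by move: h1; rewrite dE h2 mem_iota; lia.
  have dE' e' : (e' \in e :: done) =
      [&& e' < q, sel Q e' & (key e' < u) || (key e' == u) && (e' < e.+1)].
    rewrite inE dE; have [->|ne] /= := eqVneq e' e; first by rewrite eq se ke eqxx ltnSn orbT.
    case: ltnP => //= e'q; case se' : (sel Q e') => //=.
    have := nj e'; rewrite se'; move: (key e') => c h; lia.
  have sd' : size (e :: done) <= q by apply: done_size dE'; rewrite /= eD.
  have f4e := f4 e eq se; have := first_from_le f4e => l4.
  do 4 (split; first lia).
  rewrite addn1; case: ifP => fe; rewrite fe /= in kE.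
    rewrite (lay_fld H) //; split; first lia.
    exists k.-1; first lia.
    exists u, e.+1, (f 4 e), (e :: done), f, x4; do 3 eexists; split; [|by rewrite /= kE| exact: H| |].
    + by split=> //; rewrite /= in sd' *; lia.
    + split=> //; last first.
        by split=> // e'; rewrite f5 inE; case: eqP => [->|] //=; rewrite kE andbF.
      move=> v; rewrite f3 /=; case: eqP => //= _; case: eqP => //= <-.
      by rewrite -f3 fe.
    + by rewrite ke in f4e; split=> //; rewrite /= eD.
  do 2 (split; try lia).
  split; first by have := count_size (kept Q) done; lia.
  rewrite (lay_fld (lay_set (k := 5) (lay_set (k := 3) H _ _ _) _ _ _)) // -[updf _ _ _ _ 4 e]/(f 4 e).
  split; first lia.
  exists k.-1; first lia.
  exists u, e.+1, (f 4 e), (e :: done); do 5 eexists; split; [| |do 2 (apply: lay_set => //); exact: H| |].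
  + by split=> //; rewrite /= in sd' *; lia.
  + by rewrite /= kE addn1 /= add1n.
  + rewrite /updf /=; split=> //.
      move=> v; rewrite ke eqxx /=; have [->|ne] := eqVneq v (val e); first by rewrite !eqxx.
      by rewrite f3.
    split=> [v|e']; first by case: ifP.
    by rewrite inE f5; case: eqP => [->|]; rewrite ?kE.
  + by rewrite ke in f4e; split=> //; rewrite /= eD.
- move=> k L M o [u [j [ptr [done [f [x4 [x5 [x6 [x10]]]]]]]]].
  case=> [[ks ->] -> H [f0 f2 f4 f3 [f3le f5]] [ff ud dE]] /= um.
  (* All buckets below [m] are finished and every key is below [m], so all operations with a pair
     have been handled. *)
  have dE' e : (e \in done) = (e \in [seq e <- iota 0 q | sel Q e]).
    rewrite dE mem_filter mem_iota /= add0n.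
    case: ltnP => eq /=; last by rewrite andbF.
    by have := op_lt eq; case: (sel Q e) => //=; lia.
  have cE : count (kept Q) done = cnt.
    have /permP -> : perm_eq done [seq e <- iota 0 q | sel Q e].
      by apply: uniq_perm => //; rewrite filter_uniq ?iota_uniq.
    rewrite count_filter; apply: eq_count => e /=.
    by rewrite /kept; case: (sel Q e); rewrite // andbT.
  exists u, x4, x5, x6, ptr, x10; rewrite cE; split=> //; exists f => //; split=> // e eq.
  rewrite f5 dE' mem_filter mem_iota eq andbT.
  by rewrite /kept; case: (sel Q e).
Qed.

(** * Printing the model *)

Definition out_parents i : seq nat := m :: [seq fpar n Q x | x <- iota 0 i].

Definition out_pairs i : seq nat :=
  flatten [seq [:: nat_of_bool (sgn n Q e == 1); (opn Q e).2.1; (opn Q e).2.2]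
          | e <- iota 0 i & kept Q e].

Definition out_state (o' : nat -> seq nat) (N k : nat) : assertion := fun L M o =>
  exists i x4 x5 x6 x7 x10,
  [/\ k + i = N, L = [:: n; q; D; i; x4; x5; x6; x7; m; cnt; x10], out_base M & o = o' i].

Lemma cnt_le : cnt <= q.
Proof. by apply: leq_trans (count_size _ _) _; rewrite size_iota. Qed.

Lemma runs_out_init : runs W out_init (mcost out_init) post_dedup (out_state out_parents m m).
Proof.
apply: (runs_pre _ (@runs_wp _ _ _)) => L M o [x3 [x4 [x5 [x6 [x7 [x10 [-> B ->]]]]]]] /=.
do 2 (split; first lia).
by exists 0, x4, x5, x6, x7, x10; split=> //; lia.
Qed.

Lemma runs_out_parents : runs W (While out_parent_test out_parent_body)
  (m.+1 * (tcost out_parent_test + mcost out_parent_body).+1)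
  (out_state out_parents m m) (out_state out_parents m 0).
Proof.
apply: (@runs_while _ _ _ (out_state out_parents m)).
- by move=> L M o H; exists m.
- move=> k L M o [i [x4 [x5 [x6 [x7 [x10 [ki -> B ->]]]]]]] /= im.
  have [f H [f0 _]] := B; rewrite (lay_fld H) // f0.
  have := fpar_lt n_gt0 V Qm im => lf.
  do 2 (split; first lia).
  exists k.-1; first lia.
  exists i.+1, x4, x5, x6, x7, x10; split=> //; first lia.
    by rewrite addn1.
  by rewrite /out_parents iota0S map_rcons.
- move=> k L M o [i [x4 [x5 [x6 [x7 [x10 [ki -> B ->]]]]]]] /= im.
  by exists i, x4, x5, x6, x7, x10; split=> //; lia.
Qed.

Definition out_leaves i := out_parents m ++ iota 0 i.

Lemma runs_out_reset : runs W reset_index (mcost reset_index)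
  (out_state out_parents m 0) (out_state out_leaves n n).
Proof.
apply: (runs_pre _ (@runs_wp _ _ _)) => L M o [i [x4 [x5 [x6 [x7 [x10 [ki -> B ->]]]]]]] /=.
split; first lia.
exists 0, x4, x5, x6, x7, x10; split=> //; first lia.
by rewrite /out_leaves cats0 -ki.
Qed.

Lemma runs_out_leaves : runs W (While out_leaf_test out_leaf_body)
  (n.+1 * (tcost out_leaf_test + mcost out_leaf_body).+1)
  (out_state out_leaves n n) (out_state out_leaves n 0).
Proof.
apply: (@runs_while _ _ _ (out_state out_leaves n)).
- by move=> L M o H; exists n.
- move=> k L M o [i [x4 [x5 [x6 [x7 [x10 [ki -> B ->]]]]]]] /= im.
  do 2 (split; first lia).
  exists k.-1; first lia.
  exists i.+1, x4, x5, x6, x7, x10; split=> //; first lia.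
    by rewrite addn1.
  by rewrite /out_leaves iota0S rcons_cat.
- move=> k L M o [i [x4 [x5 [x6 [x7 [x10 [ki -> B ->]]]]]]] /= im.
  by exists i, x4, x5, x6, x7, x10; split=> //; lia.
Qed.

Definition out_all i := out_leaves n ++ cnt :: out_pairs i.

Lemma runs_out_mid : runs W out_mid (mcost out_mid)
  (out_state out_leaves n 0) (out_state out_all q q).
Proof.
apply: (runs_pre _ (@runs_wp _ _ _)) => L M o [i [x4 [x5 [x6 [x7 [x10 [ki -> B ->]]]]]]] /=.
have := cnt_le => cl.
do 2 (split; first lia).
exists 0, x4, x5, x6, x7, x10; split=> //; first lia.
by have -> : i = n by [lia]; rewrite /out_all cats1.
Qed.

Lemma runs_out_pairs N : q <= N -> runs W (While out_pair_test out_pair_body)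
  (N.+1 * (tcost out_pair_test + mcost out_pair_body).+1)
  (out_state out_all q q) (fun L M o => o = out_all q).
Proof.
move=> qN; apply: (@runs_while _ _ _ (out_state out_all q)).
- by move=> L M o H; exists q.
- move=> k L M o [i [x4 [x5 [x6 [x7 [x10 [ki -> B ->]]]]]]] /= iq.
  have [f H [_ f5]] := B; rewrite (lay_fld H) // f5 //.
  have [-> -> ->] := lay_op H iq; have [lA lB] := op_lt iq.
  have s2 := sgn_le2 n_gt0 V Qm HW iq; rewrite eqb1 addn1.
  case: ifP => ki1.
    do 7 (split; first lia).
    exists k.-1; first lia.
    exists i.+1, x4; do 4 eexists; split=> //; first lia.
    rewrite /out_all /out_pairs iota0S filter_rcons ki1 map_rcons flatten_rcons.
    have -> : sgn n Q i - (sgn n Q i - 1 + (sgn n Q i - 1)) = (sgn n Q i == 1) by lia.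
    by rewrite -!cats1 -!catA.
  split; first lia.
  exists k.-1; first lia.
  exists i.+1, x4; do 4 eexists; split=> //; first lia.
  by rewrite /out_all /out_pairs iota0S filter_rcons ki1.
- move=> k L M o [i [x4 [x5 [x6 [x7 [x10 [ki -> B ->]]]]]]] /= im.
  by have -> : i = q by lia.
Qed.

End Output.

(** * The whole program *)

Definition prog_pairs :=
  While sign_test sign_body ;;
  dedup_init ;;
  While dedup_test dedup_body ;;
  out_init ;;
  While out_parent_test out_parent_body ;;
  reset_index ;;
  While out_leaf_test out_leaf_body ;;
  out_mid ;;
  While out_pair_test out_pair_body.

Definition prog :=
  prog_init ;;
  While replay_test replay_body ;;
  reset_index ;;
  While complete_test complete_body ;;
  finish_tree ;;
  prog_pairs.

Definition loop_cost b c := (tcost b + mcost c).+1.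

Definition prog_pairs_cost :=
  loop_cost sign_test sign_body +
  (mcost dedup_init +
  (3 * loop_cost dedup_test dedup_body +
  (mcost out_init +
  (2 * loop_cost out_parent_test out_parent_body +
  (mcost reset_index +
  (2 * loop_cost out_leaf_test out_leaf_body +
  (mcost out_mid +
   loop_cost out_pair_test out_pair_body))))))).

Definition prog_cost :=
  mcost prog_init +
  (loop_cost replay_test replay_body +
  (mcost reset_index +
  (2 * loop_cost complete_test complete_body +
  (mcost finish_tree +
   prog_pairs_cost)))).

Lemma runs_ex A W c t (P : A -> assertion) R : (forall x, runs W c t (P x) R) ->
  runs W c t (fun L M o => exists x, P x L M o) R.
Proof. by move=> h s [L EL [x Px]]; apply: (h x); exists L. Qed.

(** Every time bound is kept as a constant times [N], so that the constants add up along the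
    program. *)
Lemma runs_seq_mul W c1 c2 a b N t P P' R : 0 < N ->
  runs W c1 t P P' -> t <= a * N -> runs W c2 (b * N) P' R ->
  runs W (c1 ;; c2) ((a + b) * N) P R.
Proof.
move=> N0 r1 tN r2 s /(runs_seq r1 r2)[t' [s' [e l h]]]; exists t', s'; split=> //.
by apply: leq_trans l _; rewrite mulnDl leq_add2r.
Qed.

Lemma runs_le W c t t' P R : t <= t' -> runs W c t P R -> runs W c t' P R.
Proof.
by move=> tt r s /r[t1 [s1 [e l h]]]; exists t1, s1; split=> //; apply: leq_trans tt.
Qed.

Section Run.
Variables (n : nat) (Q0 : seq nop) (W N : nat).
Hypotheses (n_gt0 : 0 < n) (V0 : valid n Q0) (HW : 50 * (size Q0 + n) <= W).
Notation m := (n.-1).*2.+1.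
Notation D := (opa 2 (size Q0 + n)).
Notation res := (count (fun o : nop => o.1 != 0) Q0).
Hypothesis HN : N = n + res.

(** A completed sequence has exactly [n.-1] merges, and completion adds no resolve; this makes every
    loop bound linear in [N]. *)
Lemma runs_prog_pairs Q X : Q = Q0 ++ X -> all (fun o : nop => o.1 == 0) X ->
  valid n Q -> nnext n Q = m -> size Q = n.-1 + res /\
  runs W prog_pairs (prog_pairs_cost * N) (pre_sign n Q D)
    (fun L M o => o = out_all n Q (size Q)).
Proof.
move=> QE aX V Qm.
have szQ : size Q = n.-1 + res.
  rewrite -(count_predC (fun o : nop => o.1 == 0) Q).
  have := nnext_count n Q; rewrite Qm => h; have -> : count (fun o : nop => o.1 == 0) Q = n.-1 by lia.
  rewrite QE count_cat; have -> : count (predC (fun o : nop => o.1 == 0)) X = 0.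
    by apply/eqP; rewrite -leqn0 leqNgt -has_count; apply/negP => /hasP[o /(allP aX) /= ->].
  by rewrite addn0.
split=> //.
have sQ0 : size Q = size Q0 + size X by rewrite QE size_cat.
have HW' : D + 6 * (size Q + m) + 20 <= W.
  have := nnext_count n Q; rewrite Qm QE count_cat.
  have -> : count (fun o : nop => o.1 == 0) X = size X by apply/eqP; rewrite -all_count.
  by rewrite size_cat; lia.
have N0 : 0 < N by lia.
have c1 c : c <= c * N by rewrite leq_pmulr.
have lm k c x : x <= k * N -> x * c <= k * c * N by move=> h; rewrite mulnAC leq_mul2r h orbT.
rewrite /prog_pairs_cost.
apply: (runs_seq_mul N0 (runs_sign n_gt0 V Qm HW' (leqnn _))).
  by rewrite -[loop_cost _ _]mul1n; apply: lm; lia.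
apply: (runs_seq_mul N0 (runs_dedup_init n_gt0 Qm HW') (c1 _)).
apply: (runs_seq_mul N0 (runs_dedup n_gt0 V Qm HW' (leqnn _))).
  by apply: lm; lia.
apply: (runs_seq_mul N0 (runs_out_init n_gt0 Qm HW') (c1 _)).
apply: (runs_seq_mul N0 (runs_out_parents n_gt0 V Qm HW')).
  by apply: lm; lia.
apply: (runs_seq_mul N0 (runs_out_reset n_gt0 Qm HW') (c1 _)).
apply: (runs_seq_mul N0 (runs_out_leaves n_gt0 Qm HW')).
  by apply: lm; lia.
apply: (runs_seq_mul N0 (runs_out_mid n_gt0 Qm HW') (c1 _)).
apply: runs_le (runs_out_pairs n_gt0 V Qm HW' (leqnn _)).
by rewrite -[loop_cost _ _]mul1n; apply: lm; lia.
Qed.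

Lemma runs_prog : runs W prog (prog_cost * N)
  (fun L M o => [/\ L = nseq 11 0, M = nth 0 (minput n Q0) & o = [::]])
  (fun L M o => exists Q X,
     [/\ Q = Q0 ++ X, all (fun o : nop => o.1 == 0) X, valid n Q, nnext n Q = m &
         size Q = n.-1 + res /\ o = out_all n Q (size Q)]).
Proof.
have N0 : 0 < N by lia.
have c1 c : c <= c * N by rewrite leq_pmulr.
have lm k c x : x <= k * N -> x * c <= k * c * N by move=> h; rewrite mulnAC leq_mul2r h orbT.
have szQ0 : size Q0 = (nnext n Q0 - n) + res.
  rewrite nnext_count -(count_predC (fun o : nop => o.1 == 0) Q0).
  by rewrite addKn.
have nl := nnext_lt n_gt0 V0.
have HW40 : 40 * (size Q0 + n) <= W by lia.
apply: (runs_seq_mul N0 (runs_init n_gt0 HW40) (c1 _)).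
apply: (runs_seq_mul N0 (runs_replay n_gt0 V0 HW40)).
  by rewrite -[loop_cost _ _]mul1n; apply: lm; lia.
apply: (runs_seq_mul N0 (runs_reset n_gt0 V0 HW40) (c1 _)).
apply: (runs_seq_mul N0 (runs_complete n_gt0 HW40)).
  by apply: lm; lia.
apply: (runs_seq_mul N0 (runs_finish n_gt0 HW40) (c1 _)).
apply: runs_ex => Q s [L EL [hold [f [x5 [x6 [x10 [[V [X QE aX] Qm] EL' H F]]]]]]].
have [szQ r] := runs_prog_pairs QE aX V Qm.
have [|t [s' [e l [L2 EL2 oE]]]] := r s.
  by exists L => //; exists hold, f, x5, x6, x10.
by exists t, s'; split=> //; exists L2 => //; exists Q, X.
Qed.

End Run.

Lemma out_allE n Q (n_gt0 : 0 < n) (V : valid n Q) (Qm : nnext n Q = (n.-1).*2.+1) :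
  encodes_model (out_all n Q (size Q)) (omodel n_gt0 V Qm) (@oleaf n).
Proof.
exists (entries n Q); first exact: omodel_lists.
have E1 : [seq val (parent (stm_tree (omodel n_gt0 V Qm)) u) | u <- enum 'I_(n.-1).*2.+1] =
    [seq fpar n Q x | x <- iota 0 (n.-1).*2.+1].
  rewrite -val_enum_ord -[RHS]map_comp; apply: eq_map => u.
  exact: val_oparent.
have E2 : [seq val (oleaf v) | v <- enum 'I_n] = iota 0 n.
  by rewrite -val_enum_ord; apply: eq_map => v; rewrite val_oleaf.
have E3 : flatten [seq [:: nat_of_bool x.1; val x.2.1; val x.2.2] | x <- entries n Q] =
    out_pairs n Q (size Q).
  congr flatten; rewrite /entries -map_comp; apply/eq_in_map => i.
  rewrite mem_filter mem_iota => /andP[_ iQ] /=.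
  by rewrite !(val_ends n_gt0 V Qm iQ) // !inE eqxx ?orbT.
by rewrite E1 E2 E3 size_map size_filter /out_all /out_leaves /out_parents !cat_cons -catA.
Qed.

Theorem lemma2p12 :
  exists (prog : cmd) (c : nat),
    forall (n : nat) (G : sgraph 'I_n)
           (ss : seq (cstate 'I_n)) (ops : seq (cop 'I_n)) (p : nat),
      0 < n ->
      construction_sequence ss ops ->
      constructs ss G ->
      num_resolves ops = p ->
      exists (output : seq nat) (m : nat)
             (M : signed_tree_model 'I_m) (lf : 'I_n -> 'I_m),
        [/\ computes (c * (n + p)) prog (encode_ops ops) (c * (n + p)) output,
            encodes_model output M lf,
            model_of M lf G &
            num_pairs M <= n + p].
Proof.
(* The summand [prog_cost] pays for the time. The summand 100 pays for the word size, which must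
   reach [50 * (size ops + n)], where there are fewer than [n + p] operations. *)
exists prog, (prog_cost + 100) => n G ss ops p n_gt0 CS HG Hp.
have V0 := nops_valid n_gt0 CS.
have szn : size (nops ops) = size ops by rewrite size_map.
have Hr : count (fun o : nop => o.1 != 0) (nops ops) = p by rewrite nenc_resolves.
have HW : 50 * (size (nops ops) + n) <= (prog_cost + 100) * (n + p).
  rewrite mulnDl; apply: leq_trans (leq_addl _ _).
  have := nnext_lt n_gt0 V0; rewrite nnext_count.
  have := count_predC (fun o : nop => o.1 == 0) (nops ops).
  have -> : count (predC (fun o : nop => o.1 == 0)) (nops ops) = p by [].
  lia.
have [||t [s' [e l [L _ [Q [X [QE aX V Qm [szQ oE]]]]]]]] :=
  @runs_prog n (nops ops) _ (n + p) n_gt0 V0 HW _ (minit (encode_ops ops)).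
- by rewrite Hr.
- exists (nseq 11 0) => [r|]; first by rewrite nth_nseq if_same.
  by split=> //; rewrite /minput encode_opsE szn.
exists (out s'), _, (omodel n_gt0 V Qm), (@oleaf n); split.
- exists t, s'; split=> //; apply: leq_trans l _.
  by rewrite mulnDl leq_addr.
- by rewrite oE; exact: out_allE.
- apply: omodel_of => a b ab.
  by rewrite QE stat_cat_merges // (nops_stat n_gt0 CS HG ab).
apply: leq_trans (omodel_pairs _ _ _) _; rewrite szQ Hr; lia.
Qed.
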